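(* Let $K$ be a field. For $\gamma$ a morphism of free bipersistence modules represented by an $m\times n$ matrix, a minimal Gröbner basis for $\operatorname{im}\gamma$ has, in the worst case, $\Theta(n\cdot\min(m,n))$ elements and a total of $\Theta(mn\cdot\min(m,n))$ non-zero terms among all elements. That is: for $m,n\ge1$, let $E(m,n)$ (respectively $T(m,n)$) be the maximum of the number of elements of $G$ (respectively, of the total number of non-zero terms among all elements of $G$), over all morphisms $\gamma:F\to F'$ of free bipersistence modules with $|F|=n$ and $|F'|=m$, all ordered bases $B'$ of $F'$, and all minimal Gröbner bases $G$ of $\operatorname{im}\gamma$ with respect to $B'$. Then $E(m,n)=\Theta(n\cdot\min(m,n))$ and $T(m,n)=\Theta(mn\cdot\min(m,n))$.
   Context: A bipersistence module is a $K[x_1,x_2]$-module $M$ with a vector space decomposition $M=\bigoplus_{\mathbf z\in\mathbb Z^2}M_{\mathbf z}$ such that $x_iM_{\mathbf z}\subset M_{\mathbf z+\mathbf e_i}$. Morphisms are module homomorphisms preserving grades. $\mathbb Z^2$ carries the product partial order. A bipersistence module is free if it is isomorphic to a direct sum of modules $Q^{\mathbf g}$, $\mathbf g\in\mathbb Z^2$, where $Q^{\mathbf g}_{\mathbf z}=K$ if $\mathbf g\le\mathbf z$ and $0$ otherwise, with identity maps between the copies of $K$. A basis of a free module $F$ is a minimal homogeneous generating set; $|F|$ denotes its cardinality. For a homogeneous element $b$, $\mathrm{gr}(b)$ is its grade. Given an ordered basis $B$ of a finitely generated free module $F$ and $v\in F_{\mathbf z}$, $[v]^B\in K^{|B|}$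 is the unique vector with $[v]^B_i=0$ if $\mathrm{gr}(B_i)\not\le\mathbf z$ and $v=\sum_{i:\mathrm{gr}(B_i)\le \mathbf z}[v]^B_i x^{\mathbf z-\mathrm{gr}(B_i)}B_i$. A morphism $\gamma:F\to F'$ with ordered bases $B,B'$ is represented by the $|B'|\times|B|$ matrix whose $j$-th column is $[\gamma(B_j)]^{B'}$ (with columns and rows labeled by the grades of the basis elements). Gröbner bases: the pivot of a nonzero vector $v$ is $\max\{i: v_i\neq0\}$. For a free module $F'$ with ordered basis $B'$ and nonzero $u\in F'_{\mathbf z}$ such that $[u]^{B'}$ has pivot $i$, the leading term is $\mathrm{LT}(u)=[u]^{B'}_i x^{\mathbf z-\mathrm{gr}(B'_i)}B'_i$. For a homogeneous submodule $N\subset F'$, $\mathrm L(N)$ is the submodule generated by the leading terms of the nonzero homogeneous elements of $N$. A set $G$ of homogeneous generators of $N$ is a Gröbner basis of $N$ if $\mathrm L(N)=\langle \mathrm{LT}(g): g\in G\rangle$; it is minimal if no proper subset of $G$ is a Gröbner basis of $N$. The number of non-zero terms of a homogeneous element $g$ is the number of nonzero entries of $[g]^{B'}$. *)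

(* Defs.v *)
From HB Require Import structures.
From mathcomp Require Import all_boot all_order all_algebra.
From mathcomp Require Import boolp classical_sets functions cardinality fsbigop.
From mathcomp Require Import mpoly.

Set Implicit Arguments.
Unset Strict Implicit.
Unset Printing Implicit Defensive.

Import Order.TTheory GRing.Theory Num.Theory.
(* [DefaultProdOrder] makes [(z <= w)%O] on [int * int] the product order. *)
Import DefaultProdOrder.

Local Open Scope classical_set_scope.
Local Open Scope ring_scope.

Notation grade := (int * int)%type.

Definition unit_grade (i : 'I_2) : grade := ((i == 0)%:Z, (i == 1)%:Z).

(* x^d; only meaningful for d >= 0, the only case in which it is used. *)
Definition xpow (K : fieldType) (d : grade) : {mpoly K[2]} :=
  'X_0 ^+ `|d.1|%N * 'X_1 ^+ `|d.2|%N.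

(* A K[x_1, x_2]-module M with a decomposition M = \bigoplus_z M_z into
   K-subspaces (K acts through the constant polynomials): every element is, in
   a unique way, the sum of a finitely supported family (v_z)_z, v_z in M_z. *)
Record bipersistence_module (K : fieldType) := BipersistenceModule {
  bpm_carrier :> lmodType {mpoly K[2]};
  piece : grade -> set bpm_carrier;
  piece0 : forall z, piece z 0;
  piece_linear : forall z (c : K) u v,
    piece z u -> piece z v -> piece z (c%:MP *: u + v);
  piece_direct : forall v : bpm_carrier, exists! f : grade -> bpm_carrier,
    [/\ forall z, piece z (f z),
        finite_set [set z | f z <> 0] &
        v = \sum_(z \in [set: grade]) f z];
  piece_var : forall z (i : 'I_2) v,
    piece z v -> piece (z + unit_grade i) ('X_i *: v)
}.
Arguments piece {K} M z : rename.

Section Modules.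
Variable K : fieldType.
Implicit Types M N : bipersistence_module K.

Definition homogeneous M : set M := [set v | exists z, piece M z v].

(* The grade of a homogeneous element; it is unique as soon as v != 0. *)
Definition gr M (v : M) : grade := xget 0 [set z | piece M z v].

(* Morphisms of bipersistence modules are the graded linear maps. *)
Definition graded M N (f : M -> N) : Prop :=
  forall z v, piece M z v -> piece N z (f v).

Definition isomorphic M N : Prop :=
  exists (f : {linear M -> N}) (g : {linear N -> M}),
    [/\ graded f, graded g, cancel f g & cancel g f].

Definition submodule M (S : set M) : Prop :=
  S 0 /\ forall (a : {mpoly K[2]}) u v, S u -> S v -> S (a *: u + v).

Definition generated M (S : set M) : set M := smallest (@submodule M) S.

Definition homogeneous_generators M (S L : set M) : Prop :=
  S `<=` @homogeneous M /\ generated S = L.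

End Modules.
Arguments homogeneous {K} M _.

Section FreeModules.
Variable K : fieldType.

(* Q^g is carried by K[x_1, x_2], with Q^g_z := K x^(z - g) if g <= z and 0
   otherwise: x^(w - z) then maps the generator of Q^g_z to that of Q^g_w. *)
Definition Qpiece (g z : grade) : set {mpoly K[2]} :=
  [set p | if (g <= z)%O then exists c : K, p = c *: xpow K (z - g) else p = 0].

Let expo (d : grade) : 'X_{1..2} := (U_(0%R) *+ `|d.1| + U_(1%R) *+ `|d.2|)%MM.
Let deg (m : 'X_{1..2}) : grade := ((m 0)%:Z, (m 1)%:Z).

Let xpowE d : xpow K d = 'X_[expo d].
Proof. by rewrite /xpow /expo mpolyXD -!mpolyXn. Qed.

Let degK m : expo (deg m) = m.
Proof.
apply/mnmP => i; rewrite mnmDE !mulmnE !mnm1E /=.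
by case: i => [[|[|//]] lti] /=; rewrite ?mul0n ?mul1n ?addn0 ?add0n;
  congr (m _); apply: val_inj.
Qed.

Let expoK (d : grade) : 0 <= d.1 -> 0 <= d.2 -> deg (expo d) = d.
Proof.
case: d => a b /= a0 b0; rewrite /deg /expo !mnmDE !mulmnE !mnm1E /=.
by rewrite mul1n mul0n addn0 mul1n add0n !gez0_abs.
Qed.

Let expo_unit (d : grade) i : 0 <= d.1 -> 0 <= d.2 ->
  expo (d + unit_grade i) = (U_(i) + expo d)%MM.
Proof.
case: d => [[a|//] [b|//]] /= _ _; apply/mnmP => k.
rewrite /expo /unit_grade /= !mnmDE !mulmnE !mnm1E.
by case: i => [[|[|//]] ?]; case: k => [[|[|//]] ?] /=;
  rewrite ?mul0n ?mul1n ?addn0 ?add0n ?addr0 ?addn1 //= ?addn1 ?add1n.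
Qed.

Let leZ2 (g z : grade) : (g <= z)%O = (0 <= (z - g).1) && (0 <= (z - g).2).
Proof. by rewrite leEprod /= !subr_ge0. Qed.

Let QpieceP g z (p : {mpoly K[2]}) :
  Qpiece g z p <-> forall m, g + deg m != z -> p@_m = 0.
Proof.
rewrite /Qpiece /=; case: ifPn => [gz|Ngz]; split.
- case=> c -> m; rewrite xpowE mcoeffZ mcoeffX.
  have [<-|_] := eqVneq (expo (z - g)) m; last by rewrite mulr0.
  move: gz; rewrite leZ2 => /andP[? ?].
  by rewrite expoK // addrC subrK eqxx.
- move=> p0; exists p@_(expo (z - g)); apply/mpolyP => m.
  rewrite xpowE mcoeffZ mcoeffX.
  have [<-|ne] := eqVneq (expo (z - g)) m; first by rewrite mulr1.
  rewrite mulr0 p0 //; apply: contra ne => /eqP <-.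
  by rewrite addrC addKr degK.
- by move=> -> m _; rewrite mcoeff0.
- move=> p0; apply/mpolyP => m; rewrite mcoeff0 p0 //.
  apply: contra Ngz => /eqP <-; rewrite leEprod /=.
  by rewrite !lerDl.
Qed.

Let Qpiece_coef g z (p : {mpoly K[2]}) m :
  Qpiece g z p -> g + deg m != z -> p@_m = 0.
Proof. by move/QpieceP => /[apply]. Qed.

Section DirectSum.
Variables (r : nat) (g : 'I_r -> grade).
Let V : lmodType {mpoly K[2]} := 'rV[{mpoly K[2]}]_r.

Definition sumQ_piece (z : grade) : set V :=
  [set v | forall i, Qpiece (g i) z (v 0 i)].

Let sumQ_piece0 z : sumQ_piece z 0.
Proof. by move=> i; apply/QpieceP => m _; rewrite mxE mcoeff0. Qed.

Let sumQ_piece_linear z (c : K) u v :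
  sumQ_piece z u -> sumQ_piece z v -> sumQ_piece z (c%:MP *: u + v).
Proof.
move=> uz vz i; apply/QpieceP => m ne; rewrite !mxE mcoeffD mcoeffCM.
by rewrite (Qpiece_coef (uz i) ne) (Qpiece_coef (vz i) ne) mulr0 addr0.
Qed.

Let sumQ_piece_var z (i : 'I_2) v :
  sumQ_piece z v -> sumQ_piece (z + unit_grade i) ('X_i *: v).
Proof.
move=> vz j; have := vz j; rewrite /Qpiece /= !mxE.
case: ifPn => [gz [c ->]|_ ->]; last first.
  by rewrite mulr0; case: ifP => // _; exists 0; rewrite scale0r.
rewrite ifT; last first.
  apply: (le_trans gz); rewrite leEprod /= !lerDl.
  by case: (i == 0); case: (i == 1).
exists c; rewrite -scalerAr; congr (_ *: _).
move: gz; rewrite leZ2 => /andP[d1 d2].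
by rewrite addrAC !xpowE expo_unit // mpolyXD.
Qed.

Let coef_sum (h : grade -> V) :
  (forall z, sumQ_piece z (h z)) -> finite_set [set z | h z <> 0] ->
  forall i m, ((\sum_(z \in [set: grade]) h z) 0 i)@_m =
              (h (g i + deg m) 0 i)@_m.
Proof.
move=> hz hfin i m.
have [s us sE] : exists2 s : seq grade, uniq s &
    forall z, z \notin s -> h z = 0.
  case/finite_seqP: hfin => s sE; exists (undup s); first exact: undup_uniq.
  move=> z; rewrite mem_undup => zs; apply: contrapT => hz0.
  by move/negP: zs; apply; have : [set z | h z <> 0] z by []; rewrite sE.
rewrite (fsbigE s) //; last by move=> z _; exact: sE.
rewrite (eq_bigl xpredT); last by move=> z; apply/mem_set.
have -> : ((\sum_(z <- s) h z) 0 i)@_m = \sum_(z <- s) (h z 0 i)@_m.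
  by elim/big_rec2: _ => [|z x y _ <-]; rewrite mxE ?mcoeff0 ?mcoeffD.
have other z : z != g i + deg m -> (h z 0 i)@_m = 0.
  by rewrite eq_sym; apply: Qpiece_coef; exact: hz.
have [ms|Nms] := boolP (g i + deg m \in s).
  by rewrite (bigD1_seq _ ms) //= big1 ?addr0 // => z; exact: other.
rewrite sE // mxE mcoeff0 big_seq big1 // => z zs; apply: other.
by apply: contraNneq Nms => <-.
Qed.

Let sumQ_piece_direct (v : V) : exists! f : grade -> V,
  [/\ forall z, sumQ_piece z (f z),
      finite_set [set z | f z <> 0] &
      v = \sum_(z \in [set: grade]) f z].
Proof.
pose f (z : grade) : V := \row_i
  if (g i <= z)%O then (v 0 i)@_(expo (z - g i)) *: xpow K (z - g i) else 0.
have fz z : sumQ_piece z (f z).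
  by move=> i; rewrite /Qpiece /= mxE; case: (g i <= z)%O => //; eexists.
have ffin : finite_set [set z | f z <> 0].
  pose s := [seq g i + deg m | i <- enum 'I_r, m <- msupp (v 0 i)].
  apply: (@sub_finite_set _ _ [set` s]) => // z /= fz0.
  have [i fi0] : exists i, f z 0 i != 0.
    apply: contrapT => f0; apply: fz0; apply/rowP => i; rewrite [RHS]mxE.
    by apply/eqP/negPn/negP => fi0; apply: f0; exists i.
  move: fi0; rewrite mxE; case: ifPn => [gz|]; last by rewrite eqxx.
  rewrite scaler_eq0 negb_or => /andP[vm _].
  apply/allpairsPdep; exists i, (expo (z - g i)).
  rewrite mem_enum mcoeff_msupp; split=> //.
  move: gz; rewrite leZ2 => /andP[? ?].
  by rewrite expoK // addrC subrK.
exists f; split.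
  split=> //; apply/rowP => i; apply/mpolyP => m.
  rewrite coef_sum // mxE ifT; last by rewrite leEprod /= !lerDl.
  by rewrite [g i + _]addrC addrK xpowE !degK mcoeffZ mcoeffX eqxx mulr1.
move=> h [hz hfin vE]; apply/funext => z; apply/rowP => i; apply/mpolyP => m.
have [zE|ne] := eqVneq (g i + deg m) z.
  have := congr1 (fun w : V => (w 0 i)@_m) vE; rewrite coef_sum // => vh.
  rewrite -zE -vh mxE ifT; last by rewrite leEprod /= !lerDl.
  by rewrite [g i + _]addrC addrK xpowE !degK mcoeffZ mcoeffX eqxx mulr1.
by rewrite (Qpiece_coef (hz z i) ne) (Qpiece_coef (fz z i) ne).
Qed.

(* \bigoplus_(i < r) Q^(g i) *)
Definition sumQ : bipersistence_module K :=
  BipersistenceModule sumQ_piece0 sumQ_piece_linear sumQ_piece_direct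
    sumQ_piece_var.

End DirectSum.
End FreeModules.

Section Groebner.
Variable K : fieldType.
Implicit Type F : bipersistence_module K.

Definition fg_free F : Prop :=
  exists r (g : 'I_r -> grade), isomorphic F (sumQ K g).

(* An ordered basis: an enumeration without repetition of a minimal homogeneous
   generating set. *)
Definition ordered_basis F k (B : 'I_k -> F) : Prop :=
  [/\ injective B,
      homogeneous_generators (range B) setT &
      forall S : set F, S `<` range B -> ~ homogeneous_generators S setT].

(* |F| = k. *)
Definition free_rank F (k : nat) : Prop :=
  exists B : 'I_k -> F, ordered_basis B.

Section Coordinates.
Variables (F : bipersistence_module K) (k : nat) (B : 'I_k -> F).

(* [v]^B for v in F_z with z = gr v, as the unique vector with the defining
   property. *)
Definition coords (v : F) : 'cV[K]_k :=
  xget 0 [set c : 'cV[K]_k |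
    (forall i, ~~ (gr (B i) <= gr v)%O -> c i 0 = 0) /\
    v = \sum_(i < k | (gr (B i) <= gr v)%O)
          (c i 0 *: xpow K (gr v - gr (B i))) *: B i].

Definition is_pivot (c : 'cV[K]_k) (i : 'I_k) : bool :=
  (c i 0 != 0) && [forall j, (c j 0 != 0) ==> (j <= i)%N].

Definition LT (u : F) : F :=
  if [pick i | is_pivot (coords u) i] is Some i
  then (coords u i 0 *: xpow K (gr u - gr (B i))) *: B i
  else 0.

Definition leading_terms (S : set F) : set F :=
  [set LT u | u in [set u | [/\ S u, homogeneous F u & u <> 0]]].

(* L(N). *)
Definition leading_module (N : set F) : set F := generated (leading_terms N).

Definition groebner_basis (N G : set F) : Prop :=
  homogeneous_generators G N /\
  leading_module N = generated (leading_terms G).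

Definition minimal_groebner_basis (N G : set F) : Prop :=
  groebner_basis N G /\
  forall G' : set F, G' `<` G -> ~ groebner_basis N G'.

Definition nb_terms (u : F) : nat := #|[pred i | coords u i 0 != 0]|.

End Coordinates.

(* A morphism of free modules with |F| = n and |F'| = m, an ordered basis B' of
   F', and a minimal Groebner basis of its image with respect to B'. *)
Record gb_instance (m n : nat) := GbInstance {
  gb_source : bipersistence_module K;
  gb_target : bipersistence_module K;
  gb_map : {linear gb_source -> gb_target};
  gb_basis : 'I_m -> gb_target;
  gb_set : set gb_target;
  gb_source_free : fg_free gb_source;
  gb_source_rank : free_rank gb_source n;
  gb_target_free : fg_free gb_target;
  gb_map_graded : graded gb_map;
  gb_basisP : ordered_basis gb_basis;
  gb_setP : minimal_groebner_basis gb_basis (range gb_map) gb_set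
}.

Arguments gb_basis {m n} I _ : rename.
Arguments gb_set {m n} I _ : rename.

Definition total_terms m n (I : gb_instance m n) : nat :=
  (\sum_(g \in gb_set I) nb_terms (gb_basis I) g)%N.

Definition max_elements (m n e : nat) : Prop :=
  (exists I : gb_instance m n, (gb_set I #= `I_e)%card) /\
  forall I : gb_instance m n, (gb_set I #<= `I_e)%card.

(* Finiteness is required explicitly because \sum_(g \in G) is 0 by convention
   on infinite supports. *)
Definition max_terms (m n t : nat) : Prop :=
  (exists I : gb_instance m n, finite_set (gb_set I) /\ total_terms I = t) /\
  forall I : gb_instance m n,
    finite_set (gb_set I) /\ (total_terms I <= t)%N.

End Groebner.

(* f(m, n) = Theta(g(m, n)), uniformly in m, n >= 1. *)
Definition Theta (f g : nat -> nat -> nat) : Prop :=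
  exists c C : rat, [/\ 0 < c, 0 < C &
    forall m n, (0 < m)%N -> (0 < n)%N ->
      c * (g m n)%:R <= (f m n)%:R <= C * (g m n)%:R].

(* Main.v *)
Require Import Defs.
From mathcomp Require Import all_boot all_order all_algebra.
From mathcomp Require Import boolp classical_sets functions cardinality fsbigop.
From mathcomp Require Import mpoly.
From mathcomp Require Import zify.

(** Fix an ordered basis B of the target, of size m. An element of grade z is a
    vector of K^m, and multiplying it by a monomial only raises the grade
    ([combination_shift]). So N = im gamma is an increasing family of subspaces
    N_z of K^m, N_z being the span of those of the n columns of the matrix whose
    grade is at most z ([column_combination_exists]). Leading terms with
    different pivots do not interact: a set G of homogeneous elements of N is a
    Groebner basis exactly when for every homogeneous u in N it has an element
    with the pivot of u and a grade below that of u ([groebner_basisP]). For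
    each i the grades at which i is a pivot form an up-set, and a minimal
    Groebner basis has one element per minimal grade of each of these up-sets
    ([minimal_groebner_basisP]). All this rests on the fact that a minimal
    homogeneous generating set of a free module is linearly independent
    ([basis_independent]).

    Upper bound. The number of pivots is at most the rank of the matrix, hence
    at most min(m, n). The abscissa of a minimal grade is the abscissa of one of
    the n columns, since N_z does not change elsewhere. As two minimal grades
    for the same pivot are incomparable, a minimal Groebner basis injects into
    the pairs (abscissa, pivot): it has at most n min(m, n) elements, each with
    at most m terms ([minimal_groebner_card]).

    Lower bound. Give the columns v_0, ..., v_(n-1) the grades (j, n - 1 - j),
    an antichain in which the columns below the join of the grades of
    v_j, ..., v_(j+k) are exactly these k + 1 columns. Let the r last rows of
    v_j be the binomial coefficients C(j, q), q < r, the row q = 0 being the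
    last one. By Pascal's rule the k-th difference of the columns at j has
    entries C(j, q - k), so its pivot is the row q = k; and since the matrix of
    binomial coefficients is unimodular, over any field it is up to a scalar the
    only combination of v_j, ..., v_(j+k) with this pivot, and it needs both
    v_j and v_(j+k) ([pivot_column]). Thus every minimal Groebner basis contains
    a multiple of each k-th difference with k < r and j + k < n
    ([staircase_element]). To make these elements dense, the other m - r rows
    are translates of the sequence s with s_(t+2) = s_(t+1) - s_t, s_0 = 0 and
    s_1 = 1. Its k-th difference is its own translate by 2k and it has no two
    consecutive zeros, so about half of these rows are nonzero in each element
    ([column_support]). With r = ceil(min(m, n) / 2) this gives at least
    n min(m, n) / 4 elements, each with at least m / 4 terms. *)

Set Implicit Arguments.
Unset Strict Implicit.
Unset Printing Implicit Defensive.

Import Order.TTheory GRing.Theory Num.Theory.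
Import DefaultProdOrder.

Local Open Scope classical_set_scope.
Local Open Scope ring_scope.


(** * Graded modules: homogeneous components and generation *)

Section Grades.

Lemma le_grade (g z : grade) : (g <= z)%O = (g.1 <= z.1) && (g.2 <= z.2).
Proof. by rewrite leEprod. Qed.

Lemma grade_subr_ge0 (g z : grade) : ((0 : grade) <= (z - g : grade))%O = (g <= z)%O.
Proof. by rewrite !le_grade /= !subr_ge0. Qed.

Lemma grade_lerDl (z d : grade) : ((0 : grade) <= d)%O -> (z <= (z + d : grade))%O.
Proof. by rewrite !le_grade /= !lerDl. Qed.

End Grades.

Section Monomials.
Variable K : fieldType.
Notation R := {mpoly K[2]}.

Definition monomial_grade (m : 'X_{1..2}) : grade := ((m 0)%:Z, (m 1)%:Z).

Lemma monomial_grade_ge0 m : ((0 : grade) <= monomial_grade m)%O.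
Proof. by rewrite le_grade. Qed.

Lemma xpow_monomial_grade m : xpow K (monomial_grade m) = 'X_[m].
Proof.
rewrite /xpow /monomial_grade /= !mpolyXn -mpolyXD; congr 'X_[_].
apply/mnmP => i; rewrite mnmDE !mulmnE !mnm1E.
by case: i => [[|[|//]] lti] /=; rewrite ?mul0n ?mul1n ?addn0 ?add0n;
  congr (m _); apply: val_inj.
Qed.

Lemma xpow0 : xpow K 0 = 1.
Proof. by rewrite /xpow /= !expr0 mulr1. Qed.

Lemma xpowD (d e : grade) : ((0 : grade) <= d)%O -> ((0 : grade) <= e)%O ->
  xpow K d * xpow K e = xpow K (d + e).
Proof.
case: d e => [a b] [a' b']; rewrite !le_grade /= => /andP[a0 b0] /andP[a0' b0'].
rewrite /xpow /= mulrACA -!exprD.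
by congr (_ ^+ _ * _ ^+ _); lia.
Qed.

Lemma xpow_neq0 d : xpow K d != 0.
Proof.
have X0 i : 'X_i != 0 :> R.
  apply/eqP => /(congr1 (mcoeff U_(i))); rewrite mcoeffX eqxx mcoeff0 => /eqP.
  by rewrite oner_eq0.
by rewrite mulf_neq0 // expf_neq0.
Qed.

End Monomials.

Section HomogeneousComponents.
Variables (K : fieldType) (M : bipersistence_module K).
Implicit Types (u v : M) (z w d : grade) (S : set M).
Notation R := {mpoly K[2]}.

Lemma pieceD z u v : piece M z u -> piece M z v -> piece M z (u + v).
Proof. by move=> uz vz; have := piece_linear 1 uz vz; rewrite mpolyC1 scale1r. Qed.

Lemma pieceC z c v : piece M z v -> piece M z (c%:MP *: v).
Proof. by move=> vz; have := piece_linear c vz (piece0 M z); rewrite addr0. Qed.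

Lemma piece_sum z (I : Type) (r : seq I) (P : pred I) (F : I -> M) :
  (forall i, P i -> piece M z (F i)) -> piece M z (\sum_(i <- r | P i) F i).
Proof.
move=> Fz; elim/big_rec: _ => [|i v Pi]; first exact: piece0.
by apply: pieceD; apply: Fz.
Qed.

Lemma piece_xpow z d v : ((0 : grade) <= d)%O ->
  piece M z v -> piece M (z + d) (xpow K d *: v).
Proof.
have piece_pow i k w u : piece M w u ->
    piece M (w + unit_grade i *+ k) ('X_i ^+ k *: u).
  move=> uw; elim: k => [|k IH]; first by rewrite expr0 scale1r mulr0n addr0.
  by rewrite exprS mulrSr addrA -scalerA; apply: piece_var.
case: d => [[a|//] [b|//]]; rewrite le_grade //= => _ vz.
rewrite /xpow /= mulrC -scalerA.
suff -> : z + (Posz a, Posz b) = z + unit_grade 0 *+ a + unit_grade 1 *+ b.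
  by apply: (piece_pow 1 b); apply: (piece_pow 0 a).
rewrite -addrA; congr (_ + _).
have pE (x y : int) k : (x, y) *+ k = (x *+ k, y *+ k) :> grade.
  by elim: k => // k IH; rewrite !mulrS IH.
by rewrite /unit_grade !pE /= !mul0rn !natz /GRing.add /= /add_pair /= addr0 add0r.
Qed.

Definition component z v : M := sval (cid (piece_direct v)) z.

Lemma component_piece z v : piece M z (component z v).
Proof. by rewrite /component; case: cid => f [[]]. Qed.

Lemma component_unique v (f : grade -> M) :
  [/\ forall z, piece M z (f z), finite_set [set z | f z <> 0] &
      v = \sum_(z \in [set: grade]) f z] -> forall z, component z v = f z.
Proof.
by rewrite /component; case: cid => h /= [_ uniq_h] /uniq_h ->.
Qed.

Lemma fin_support_seq (f : grade -> M) : finite_set [set z | f z <> 0] ->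
  exists2 s : seq grade, uniq s & forall z, z \notin s -> f z = 0.
Proof.
case/finite_seqP => s sE; exists (undup s); first exact: undup_uniq.
move=> z; rewrite mem_undup => zs; apply: contrapT => fz0.
by move/negP: zs; apply; have : [set z | f z <> 0] z by []; rewrite sE.
Qed.

Lemma fsbig_seq (f : grade -> M) (s : seq grade) : uniq s ->
  (forall z, z \notin s -> f z = 0) ->
  \sum_(z \in [set: grade]) f z = \sum_(z <- s) f z.
Proof.
move=> us sE; rewrite (fsbigE s) //; last by move=> z _; exact: sE.
by apply: eq_bigl => z; apply/mem_set.
Qed.

Lemma component_seqP v (f : grade -> M) (s : seq grade) :
  uniq s -> (forall z, piece M z (f z)) -> (forall z, z \notin s -> f z = 0) ->
  v = \sum_(z <- s) f z -> forall z, component z v = f z.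
Proof.
move=> us fz sE ->; apply: component_unique; split=> //.
  apply: (@sub_finite_set _ _ [set` s]) => // z /= fz0.
  by apply/negPn/negP => /sE.
by rewrite (fsbig_seq us sE).
Qed.

Lemma component_sum v : exists2 s : seq grade, uniq s &
  (forall z, z \notin s -> component z v = 0) /\
  v = \sum_(z <- s) component z v.
Proof.
rewrite /component; case: cid => f [[fz ffin vE] _] /=.
have [s us sE] := fin_support_seq ffin.
by exists s => //; split=> //; rewrite -(fsbig_seq us sE).
Qed.

Lemma component_id z w v : piece M z v -> component w v = if w == z then v else 0.
Proof.
move=> vz; apply: (@component_seqP _ (fun w => if w == z then v else 0) [:: z]) => //.
- by move=> w'; case: eqP => [->//|_]; apply: piece0.
- by move=> w'; rewrite inE => /negbTE ->.
- by rewrite big_seq1 eqxx.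
Qed.

Lemma component_in z v : piece M z v -> component z v = v.
Proof. by move=> /component_id ->; rewrite eqxx. Qed.

Lemma component_out z w v : piece M z v -> w != z -> component w v = 0.
Proof. by move=> /component_id ->; case: eqP. Qed.

Lemma componentD z u v : component z (u + v) = component z u + component z v.
Proof.
have [s us [sE uE]] := component_sum u; have [t ut [tE vE]] := component_sum v.
pose st := undup (s ++ t).
have ext f (r : seq grade) : uniq r -> (forall z, z \notin r -> f z = 0 :> M) ->
    {subset r <= st} -> \sum_(z <- r) f z = \sum_(z <- st) f z.
  move=> ur rE rs; rewrite -!fsbig_seq ?undup_uniq // => w ws.
  by apply: rE; apply: contra ws; exact: rs.
apply: (@component_seqP _ (fun z => component z u + component z v) st).
- exact: undup_uniq.
- by move=> w; apply: pieceD; apply: component_piece.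
- move=> w; rewrite mem_undup mem_cat negb_or => /andP[ws wt].
  by rewrite sE // tE // addr0.
rewrite big_split /= -(ext _ s) // -?(ext _ t) // -?uE -?vE //.
- by move=> w ws; rewrite mem_undup mem_cat ws orbT.
- by move=> w ws; rewrite mem_undup mem_cat ws.
Qed.

Lemma component0 z : component z 0 = 0.
Proof. exact/component_in/piece0. Qed.

Lemma component_big z (I : Type) (r : seq I) (F : I -> M) :
  component z (\sum_(i <- r) F i) = \sum_(i <- r) component z (F i).
Proof.
elim: r => [|i r IH]; first by rewrite !big_nil component0.
by rewrite !big_cons componentD IH.
Qed.

Lemma component_monomial z (c : K) d v : ((0 : grade) <= d)%O ->
  component z ((c *: xpow K d) *: v) = (c *: xpow K d) *: component (z - d) v.
Proof.
move=> d0; have [s us [sE {1}->]] := component_sum v.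
rewrite scaler_sumr component_big.
have pc w : piece M (w + d) ((c *: xpow K d) *: component w v).
  rewrite -mul_mpolyC -scalerA; apply/pieceC/piece_xpow => //.
  exact: component_piece.
transitivity (\sum_(w <- s) if w == z - d then (c *: xpow K d) *: component w v else 0).
  apply: eq_bigr => w _; rewrite (component_id _ (pc w)).
  by rewrite [w == _]eq_sym subr_eq.
have [zs|zs] := boolP (z - d \in s).
  rewrite (bigD1_seq _ zs) //= eqxx big1 ?addr0 // => w /negbTE -> //.
rewrite sE // scaler0 big_seq big1 // => w ws.
by case: eqP zs => // <-; rewrite ws.
Qed.

Lemma piece_inj z w v : piece M z v -> piece M w v -> v <> 0 -> z = w.
Proof.
move=> vz vw v0; apply/eqP/negPn/negP => zw; apply: v0.
by rewrite -(component_in vz) (component_out vw zw).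
Qed.

Lemma gr_piece z v : piece M z v -> v <> 0 -> gr v = z.
Proof.
move=> vz v0; rewrite /gr; case: xgetP => [w _ vw|]; last by move/(_ z).
exact: piece_inj vw vz v0.
Qed.

Lemma piece_gr v : homogeneous M v -> piece M (gr v) v.
Proof. by move=> [z vz]; rewrite /gr; case: xgetP => [//|/(_ z)]. Qed.

End HomogeneousComponents.

Section Generation.
Variables (K : fieldType) (M : bipersistence_module K).
Implicit Types (u v : M) (z w d : grade) (S T : set M).

Lemma submodule_generated S : submodule (generated S).
Proof.
split=> [A [[A0 _] _] //|a u v Su Sv A [AM AS]].
by apply: AM.2; [apply: Su | apply: Sv].
Qed.

Lemma sub_generated S : S `<=` generated S.
Proof. by move=> v Sv A [_]; apply. Qed.

Lemma generated_min S T : submodule T -> S `<=` T -> generated S `<=` T.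
Proof. exact: smallest_sub. Qed.

Lemma generated_sub S T : S `<=` generated T -> generated S `<=` generated T.
Proof. by apply: generated_min; apply: submodule_generated. Qed.

Section Submodule.
Variables (N : set M) (subN : submodule N).

Lemma submodZ a v : N v -> N (a *: v).
Proof. by move=> Nv; have := subN.2 a _ _ Nv subN.1; rewrite addr0. Qed.

Lemma submodD u v : N u -> N v -> N (u + v).
Proof. by move=> Nu Nv; have := subN.2 1 _ _ Nu Nv; rewrite scale1r. Qed.

Lemma submodN v : N v -> N (- v).
Proof. by move=> Nv; rewrite -scaleN1r; apply: submodZ. Qed.

Lemma submodB u v : N u -> N v -> N (u - v).
Proof. by move=> Nu Nv; apply: submodD => //; apply: submodN. Qed.

Lemma submod_sum (I : Type) (r : seq I) (P : pred I) (F : I -> M) :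
  (forall i, P i -> N (F i)) -> N (\sum_(i <- r | P i) F i).
Proof.
move=> NF; elim/big_rec: _ => [|i v Pi]; first exact: subN.1.
by apply: submodD; apply: NF.
Qed.

End Submodule.

(** The elements of grade z reached from S with scalar coefficients. Adding one
    term at a time gives an induction principle on such elements without a choice
    of finite subfamily of S. *)
Inductive graded_span S z : M -> Prop :=
| graded_span0 : graded_span S z 0
| graded_spanS c s w v of S s & piece M w s & (w <= z)%O & graded_span S z v :
    graded_span S z ((c *: xpow K (z - w)) *: s + v).

Lemma graded_spanD S z u v :
  graded_span S z u -> graded_span S z v -> graded_span S z (u + v).
Proof.
move=> + vz; elim=> [|c s w u' Ss sw wz _ IH]; first by rewrite add0r.
by rewrite -addrA; apply: graded_spanS.
Qed.

Lemma graded_span_monomial S z c d v : ((0 : grade) <= d)%O ->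
  graded_span S z v -> graded_span S (z + d) ((c *: xpow K d) *: v).
Proof.
move=> d0; elim=> [|c' s w u Ss sw wz _ IH].
  by rewrite scaler0; apply: graded_span0.
rewrite scalerDr scalerA -scalerAl -scalerAr scalerA xpowD ?grade_subr_ge0 //.
rewrite addrA [d + z]addrC.
by apply: graded_spanS => //; apply: le_trans wz (grade_lerDl _ _).
Qed.

(** Multiplication by a monomial only shifts homogeneous components, so the
    elements whose components all lie in graded spans form a submodule. Hence a
    combination of homogeneous generators with polynomial coefficients may be
    replaced, grade by grade, by one with scalar multiples of monomials. *)
Lemma generated_graded_span S v : S `<=` homogeneous M -> generated S v ->
  forall z, graded_span S z (component z v).
Proof.
move=> homS; pose T := [set v | forall z, graded_span S z (component z v)].
suff : generated S `<=` T by move=> /[apply].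
apply: generated_min; last first.
  move=> s Ss z; have [w sw] := homS _ Ss.
  rewrite (component_id _ sw); case: eqP => [->|_]; last exact: graded_span0.
  have := @graded_spanS S w 1 s w 0 Ss sw (lexx _) (@graded_span0 _ _).
  by rewrite subrr xpow0 scale1r scale1r addr0.
split=> [z|a u w Tu Tw]; first by rewrite component0; apply: graded_span0.
move=> z; rewrite componentD; apply: graded_spanD => //.
elim/mpolyind: a => [|c m p _ _ IH].
  by rewrite scale0r component0; apply: graded_span0.
rewrite scalerDl componentD; apply: graded_spanD => //.
rewrite -xpow_monomial_grade component_monomial ?monomial_grade_ge0 //.
have := graded_span_monomial c (monomial_grade_ge0 m) (Tu (z - monomial_grade m)).
by rewrite subrK.
Qed.

Lemma generated_piece_graded_span S z v : S `<=` homogeneous M ->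
  generated S v -> piece M z v -> graded_span S z v.
Proof.
by move=> homS Sv vz; have := generated_graded_span homS Sv z; rewrite component_in.
Qed.

Lemma generated_range k (B : 'I_k -> M) v :
  generated (range B) v <-> exists p : 'I_k -> {mpoly K[2]}, v = \sum_i p i *: B i.
Proof.
split; last first.
  move=> [p ->].

  apply: (submod_sum (submodule_generated _)) => i _.
  apply: (submodZ (submodule_generated _)).
  by apply: sub_generated; exists i.
pose T := [set v | exists p : 'I_k -> {mpoly K[2]}, v = \sum_i p i *: B i].
suff : generated (range B) `<=` T by move=> /[apply].
apply: generated_min; last first.
  move=> _ [i _ <-]; exists (fun j => (j == i)%:R).
  rewrite (bigD1 i) //= eqxx scale1r big1 ?addr0 // => j /negbTE ->.
  by rewrite scale0r.
split=> [|a u w [p ->] [q ->]].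
  by exists (fun _ => 0); rewrite big1 // => i _; rewrite scale0r.
exists (fun i => a * p i + q i).
rewrite scaler_sumr -big_split /=; apply: eq_bigr => i _.
by rewrite scalerA scalerDl.
Qed.

End Generation.

(** * Bases of free modules are linearly independent *)

Section HomogeneousMatrices.
Variable K : fieldType.
Implicit Types (g z : grade) (p q : {mpoly K[2]}).

Lemma QpieceP g z p :
  Qpiece g z p <-> exists c : K, p = c *: xpow K (z - g) /\ (c != 0 -> (g <= z)%O).
Proof.
rewrite /Qpiece /=; case: ifP => gz; split.
- by move=> [c ->]; exists c.
- by move=> [c [-> _]]; exists c.
- by move=> ->; exists 0; rewrite scale0r eqxx.
- by move=> [c [-> +]]; have [->|_ /(_ isT)//] := eqVneq c 0; rewrite scale0r.
Qed.

Lemma Qpiece_sum g z (I : Type) (r : seq I) (F : I -> {mpoly K[2]}) :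
  (forall i, Qpiece g z (F i)) -> Qpiece g z (\sum_(i <- r) F i).
Proof.
move=> QF; elim/big_rec: _ => [|i q _ /QpieceP[c [-> cz]]].
  by apply/QpieceP; exists 0; rewrite scale0r eqxx.
have /QpieceP[d [-> dz]] := QF i; apply/QpieceP; exists (d + c).
rewrite scalerDl; split=> // dc0; have [d0|/dz//] := eqVneq d 0.
by apply: cz; rewrite d0 add0r in dc0.
Qed.

Lemma QpieceM g z p g' z' p' :
  Qpiece g z p -> Qpiece g' z' p' -> Qpiece (g + g') (z + z') (p * p').
Proof.
move=> /QpieceP[c [-> cz]] /QpieceP[d [-> dz]]; apply/QpieceP; exists (c * d).
have [->|c0] := eqVneq c 0; first by rewrite !(mul0r, scale0r) eqxx.
have [->|d0] := eqVneq d 0; first by rewrite !(mulr0, scale0r) eqxx.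
have {}cz := cz c0; have {}dz := dz d0; split; last first.
  by move: cz dz; rewrite !le_grade /= => /andP[? ?] /andP[? ?]; rewrite !lerD.
rewrite -scalerAl -scalerAr scalerA xpowD ?grade_subr_ge0 //.
by rewrite addrACA opprD.
Qed.

Lemma Qpiece_prod (I : Type) (r : seq I) (g z : I -> grade) (F : I -> {mpoly K[2]}) :
  (forall i, Qpiece (g i) (z i) (F i)) ->
  Qpiece (\sum_(i <- r) g i) (\sum_(i <- r) z i) (\prod_(i <- r) F i).
Proof.
move=> QF; elim: r => [|i r IH]; last by rewrite !big_cons; apply: QpieceM.
by rewrite !big_nil; apply/QpieceP; exists 1; rewrite subr0 xpow0 scale1r.
Qed.

(** A permutation only reorders the grades of the columns, so all terms of the
    Leibniz formula have the same grade. *)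
Lemma Qpiece_det r (g z : 'I_r -> grade) (P : 'M[{mpoly K[2]}]_r) :
  (forall i j, Qpiece (g j) (z i) (P i j)) ->
  Qpiece (\sum_i g i) (\sum_i z i) (\det P).
Proof.
move=> QP; apply: Qpiece_sum => s.
rewrite -[\sum_i g i]add0r -[\sum_i z i]add0r; apply: QpieceM.
  apply/QpieceP; exists ((-1) ^+ perm.odd_perm s); rewrite subr0 xpow0; split=> //.
  by rewrite -mul_mpolyC mulr1 rmorphXn /= rmorphN1.
by rewrite (reindex_inj (@perm.perm_inj _ s)) /=; apply: Qpiece_prod.
Qed.

(** A homogeneous polynomial has at most one monomial; if the constant term is
    nonzero, the polynomial is constant. *)
Lemma Qpiece_unit g z p : Qpiece g z p -> p@_0%MM != 0 -> p \is a GRing.unit.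
Proof.
move=> /QpieceP[c [-> cz]]; rewrite mcoeffZ.
have [->|c0] := eqVneq c 0; first by rewrite mul0r eqxx.
move: (cz c0); rewrite mulf_eq0 (negbTE c0) /= -grade_subr_ge0 le_grade.
case: (z - g) => [[a|//] [b|//]] _ /=.
rewrite /xpow /= !mpolyXn -mpolyXD mcoeffX.
case: (_ =P 0%MM) => [-> _|_]; last by rewrite eqxx.
rewrite mpolyX0 -mul_mpolyC mulr1.
by rewrite rmorph_unit // unitfE.
Qed.

End HomogeneousMatrices.

Section FreeBases.
Variables (K : fieldType) (F : bipersistence_module K) (m : nat) (B : 'I_m -> F).
Hypotheses (freeF : fg_free F) (basisB : ordered_basis B).

(** Let P be the matrix of the family B in the standard basis of the sum of the
    Q^(g j), and let P0 be its matrix of constant terms. As B generates, P has a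
    left inverse, so P0 has full column rank and some r rows of P0 form an
    invertible matrix. The corresponding minor of P is homogeneous with nonzero
    constant term, hence a unit: these r elements of B already generate, so by
    minimality they are all of B, and P is invertible. This is Nakayama's lemma
    made explicit. *)
Lemma basis_independent (p : 'I_m -> {mpoly K[2]}) :
  \sum_i p i *: B i = 0 -> forall i, p i = 0.
Proof.
have [r [g [phi [psi [gphi gpsi phiK psiK]]]]] := freeF.
have [injB [homB genB] minB] := basisB.
pose f i : 'rV[{mpoly K[2]}]_r := phi (B i).
pose P : 'M_(m, r) := \matrix_(i, j) f i 0 j.
have [Q QE] : exists Q : 'M[{mpoly K[2]}]_(r, m),
    forall j, psi (delta_mx 0 j : 'rV_r) = \sum_i Q j i *: B i.
  have /choice[q qE] : forall j, exists q : 'I_m -> {mpoly K[2]},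
      psi (delta_mx 0 j : 'rV_r) = \sum_i q i *: B i.
    by move=> j; apply/generated_range; rewrite genB.
  by exists (\matrix_(j, i) q j i) => j; rewrite qE; apply: eq_bigr => i _; rewrite mxE.
have phi_sum (I : finType) (c : I -> {mpoly K[2]}) (b : I -> 'I_m) :
    phi (\sum_i c i *: B (b i)) = \sum_i c i *: f (b i) :> 'rV_r.
  by rewrite linear_sum; apply: eq_bigr => i _; rewrite linearZ.
have QP1 : Q *m P = 1%:M.
  apply/row_matrixP => j; rewrite row_mul row1.
  rewrite -[RHS](psiK (delta_mx 0 j : 'rV_r)) QE phi_sum.
  rewrite mulmx_sum_row; apply: eq_bigr => i _; rewrite mxE; congr (_ *: _).
  by apply/rowP => l; rewrite !mxE.
have /choice[z zE] : forall i, exists w, piece F w (B i).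
  by move=> i; apply: homB; exists i.
have QpP i j : Qpiece (g j) (z i) (P i j).
  by rewrite mxE; apply: gphi; apply: zE.
pose P0 := map_mx (mcoeff 0%MM) P.
(* Constant terms form a ring morphism, so Q *m P = 1 survives. *)
have fullP0 : row_full P0.
  apply/row_fullP; exists (map_mx (mcoeff 0%MM) Q).
  by rewrite -map_mxM QP1 map_mx1.
pose h := fullrankfun fullP0.
have unitP : rowsub h P \in unitmx.
  rewrite unitmxE; apply: (@Qpiece_unit _ (\sum_i g i) (\sum_i z (h i))).
    by apply: Qpiece_det => i j; rewrite mxE.
  rewrite -[_@_ _]/(mcoeff 0%MM _) -det_map_mx map_mxsub -unitfE -unitmxE.
  exact: fullrowsub_unit.
have rowB (c : 'rV_r) : phi (\sum_j c 0 j *: B (h j)) = c *m rowsub h P.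
  rewrite phi_sum mulmx_sum_row; apply: eq_bigr => j _; congr (_ *: _).
  by apply/rowP => l; rewrite !mxE.
(* By minimality of B, the selected elements exhaust it. *)
have hsurj i : exists j, h j = i.
  apply: contrapT => Ni; apply: (minB (range (B \o h))).
    split=> [_ [j _ <-]|/(_ (B i))[]]; [by exists (h j) | by exists i |].
    by move=> j _ /injB ij; apply: Ni; exists j.
  split=> [_ [j _ <-]|]; first by exists (z (h j)).
  apply/seteqP; split=> // v _; apply/generated_range.
  pose c : 'rV_r := (phi v : 'rV_r) *m invmx (rowsub h P).
  exists (c 0); apply: (can_inj phiK).
  by rewrite rowB mulmxKV.
have injh := @fullrankfun_inj _ _ _ _ fullP0.
move=> p0 i; have [j <-] := hsurj i.
pose c : 'rV_r := \row_j p (h j).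
suff : c = 0 by move/rowP/(_ j); rewrite !mxE.
rewrite -(mulmxK unitP c) -rowB.
suff -> : \sum_j c 0 j *: B (h j) = 0 by rewrite linear0 mul0mx.
rewrite -[RHS]p0 [RHS](reindex h) /=; first by apply: eq_bigr => k _; rewrite mxE.
have /choice[h' h'K] := hsurj.
by exists h' => k _; [apply: injh; rewrite h'K | rewrite h'K].
Qed.

End FreeBases.

(** * Coordinate vectors and pivots *)

Section Pivots.
Variables (K : fieldType) (k : nat).
Implicit Types (c : 'cV[K]_k) (i j : 'I_k).

Lemma is_pivotP c i :
  reflect (c i 0 != 0 /\ forall j, (i < j)%N -> c j 0 = 0) (is_pivot c i).
Proof.
apply: (iffP andP) => [[ci0 /forallP h]|[ci0 h]]; split=> //.
  by move=> j ij; apply/eqP/negPn/negP => cj0; move: (h j); rewrite cj0 /= leqNgt ij.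
by apply/forallP => j; apply/implyP => cj0; rewrite leqNgt; apply: contra cj0 => /h ->.
Qed.

Lemma pivot_unique c i j : is_pivot c i -> is_pivot c j -> i = j.
Proof.
move=> /is_pivotP[ci hi] /is_pivotP[cj hj]; apply: ord_inj; apply/eqP.
rewrite eqn_leq [(i <= j)%N]leqNgt [(j <= i)%N]leqNgt; apply/andP; split; apply/negP.
  by move/hj => c0; rewrite c0 eqxx in ci.
by move/hi => c0; rewrite c0 eqxx in cj.
Qed.

Lemma pivot_exists c : c != 0 -> exists i, is_pivot c i.
Proof.
move=> c0; have [i0 ci0] : exists i, c i 0 != 0.
  by case/cV0Pn: c0 => i; exists i.
pose i := [arg max_(j > i0 | c j 0 != 0) (j : nat)]; exists i.
rewrite /i; case: arg_maxnP => // {}i ci hi; apply/andP; split=> //.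
by apply/forallP => j; apply/implyP => /hi.
Qed.

End Pivots.

Section Coordinates.
Variables (K : fieldType) (F : bipersistence_module K) (m : nat) (B : 'I_m -> F).
Implicit Types (z w : grade) (c d : 'cV[K]_m) (u v : F) (i j : 'I_m).

(** The element of grade z with coordinate vector c: this is the inverse of the
    map [coords], which is only defined by a choice. *)
Definition combination z c : F :=
  \sum_(i < m | (gr (B i) <= z)%O) (c i 0 *: xpow K (z - gr (B i))) *: B i.

(** The vectors that occur as coordinates in grade z. *)
Definition supported z c := forall i, ~~ (gr (B i) <= z)%O -> c i 0 = 0.

Lemma supported_le z w c : (z <= w)%O -> supported z c -> supported w c.
Proof. by move=> zw cz i iw; apply: cz; apply: contra iw => /le_trans; apply. Qed.

Lemma supportedP z c a d : supported z c -> supported z d -> supported z (a *: c + d).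
Proof. by move=> cz dz i iz; rewrite !mxE cz // dz // mulr0 addr0. Qed.

Lemma supported0 z : supported z 0.
Proof. by move=> i _; rewrite mxE. Qed.

Lemma supportedD z c d : supported z c -> supported z d -> supported z (c + d).
Proof. by move=> cz; rewrite -[c]scale1r; apply: supportedP. Qed.

Lemma supportedZ z a c : supported z c -> supported z (a *: c).
Proof. by move=> cz; rewrite -[_ *: _]addr0; apply/supportedP/supported0. Qed.

Lemma supportedB z c d : supported z c -> supported z d -> supported z (c - d).
Proof. by move=> cz dz; rewrite addrC -scaleN1r; apply: supportedP. Qed.

Lemma supported_sum z (I : Type) (r : seq I) (P : pred I) (f : I -> 'cV[K]_m) :
  (forall x, P x -> supported z (f x)) -> supported z (\sum_(x <- r | P x) f x).
Proof.
move=> fz; elim/big_rec: _ => [|x c Px cz]; first exact: supported0.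
by apply: supportedD => //; apply: fz.
Qed.

Lemma combinationP z a c d :
  combination z (a *: c + d) = a%:MP *: combination z c + combination z d.
Proof.
rewrite scaler_sumr -big_split; apply: eq_bigr => i _ /=.
by rewrite !mxE scalerDl scalerDl -scalerA -[a *: (_ *: _)]mul_mpolyC scalerA.
Qed.

Lemma combination0 z : combination z 0 = 0.
Proof. by rewrite /combination big1 // => i _; rewrite mxE !scale0r. Qed.

Lemma combinationD z c d : combination z (c + d) = combination z c + combination z d.
Proof. by rewrite -[c]scale1r combinationP mpolyC1 !scale1r. Qed.

Lemma combinationZ z a c : combination z (a *: c) = a%:MP *: combination z c.
Proof. by rewrite -[_ *: c]addr0 combinationP combination0 addr0. Qed.

Lemma combinationB z c d : combination z (c - d) = combination z c - combination z d.
Proof.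
have -> : c - d = -1 *: d + c by rewrite scaleN1r addrC.
by rewrite combinationP mpolyCN mpolyC1 scaleN1r addrC.
Qed.

Lemma combination_sum z (I : Type) (r : seq I) (P : pred I) (f : I -> 'cV[K]_m) :
  combination z (\sum_(x <- r | P x) f x) = \sum_(x <- r | P x) combination z (f x).
Proof. exact: (big_morph _ (combinationD z) (combination0 z)). Qed.

(** Multiplication by a monomial does not change coordinate vectors. Thus a graded
    submodule amounts to a family of subspaces of K^m that increases with the
    grade. *)
Lemma combination_shift z w c : (z <= w)%O -> supported z c ->
  xpow K (w - z) *: combination z c = combination w c.
Proof.
move=> zw cz; rewrite scaler_sumr.
rewrite [LHS]big_mkcond [RHS]big_mkcond; apply: eq_bigr => i _ /=.
case: ifPn => [iz|/cz ->]; last by rewrite !scale0r if_same.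
rewrite (le_trans iz zw) scalerA -scalerAr xpowD ?grade_subr_ge0 //.
by rewrite addrA subrK.
Qed.

Lemma supported_delta z a i : (gr (B i) <= z)%O -> supported z (a *: delta_mx i 0).
Proof.
by move=> iz j; rewrite !mxE; case: (j =P i) => [->|_ _]; rewrite ?iz ?mulr0.
Qed.

Lemma combination_delta z a i : (gr (B i) <= z)%O ->
  combination z (a *: delta_mx i 0) = (a *: xpow K (z - gr (B i))) *: B i.
Proof.
move=> iz; rewrite /combination (bigD1 i) //= big1 => [|j /andP[_ /negbTE ji]].
  by rewrite addr0 !mxE !eqxx mulr1.
by rewrite !mxE ji mulr0 !scale0r.
Qed.

Hypotheses (freeF : fg_free F) (basisB : ordered_basis B).

Lemma basis_neq0 i : B i <> 0.
Proof.
move=> Bi0; have := @basis_independent _ _ _ _ freeF basisB (fun j => (j == i)%:R) _ i.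
rewrite eqxx => h; suff /h/eqP : \sum_j (j == i)%:R *: B j = 0 by rewrite oner_eq0.
rewrite (bigD1 i) //= Bi0 scaler0 add0r big1 // => j /negbTE ->.
by rewrite scale0r.
Qed.

Lemma basis_piece i : piece F (gr (B i)) (B i).
Proof. by case: basisB => _ [homB _] _; apply: piece_gr; apply: homB; exists i. Qed.

Lemma combination_piece z c : piece F z (combination z c).
Proof.
apply: piece_sum => i iz; rewrite -mul_mpolyC -scalerA; apply: pieceC.
rewrite -{1}(subrK (gr (B i)) z) addrC.
by apply: piece_xpow; rewrite ?grade_subr_ge0 //; apply: basis_piece.
Qed.

(** Scalar coefficients times monomials are polynomial coefficients, so this is
    linear independence of the basis. *)
Lemma combination_inj z c d : supported z c -> supported z d ->
  combination z c = combination z d -> c = d.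
Proof.
move=> cz dz /eqP; rewrite -subr_eq0 -combinationB => /eqP.
have := supportedB cz dz; move: (c - d) (subr0_eq (x := c) (y := d)) => e ecd ez e0.
apply: ecd; apply/colP => i; rewrite mxE.
pose p i := if (gr (B i) <= z)%O then e i 0 *: xpow K (z - gr (B i)) else 0.
have p0 : \sum_i p i *: B i = 0.
  rewrite -[RHS]e0 /combination [RHS]big_mkcond; apply: eq_bigr => j _.
  by rewrite /p; case: ifP => // _; rewrite scale0r.
have := basis_independent freeF basisB p0 i; rewrite /p.
case: ifPn => [_|/ez//] /eqP.
by rewrite scaler_eq0 (negbTE (xpow_neq0 _ _)) orbF => /eqP.
Qed.

Lemma combination_neq0 z c : supported z c -> c != 0 -> combination z c <> 0.
Proof.
move=> cz c0 e0; move/eqP: c0; apply; apply: combination_inj cz (@supported0 _) _.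
by rewrite combination0.
Qed.

Lemma combination_exists z v : piece F z v ->
  exists2 c, supported z c & v = combination z c.
Proof.
move=> vz; have [_ [homB genB] _] := basisB.
have : graded_span (range B) z v by apply: generated_piece_graded_span => //; rewrite genB.
elim=> [|a s w u [i _ <-] iw wz _ [c cz ->]].
  by exists 0; [apply: supported0 | rewrite combination0].
have wE := gr_piece iw (@basis_neq0 i); rewrite -wE in wz *.
exists (a *: delta_mx i 0 + c).
  by apply: supportedD; first exact: supported_delta.
by rewrite combinationD combination_delta.
Qed.

Lemma gr_combination z c : supported z c -> c != 0 -> gr (combination z c) = z.
Proof. by move=> cz /(combination_neq0 cz); apply/gr_piece/combination_piece. Qed.

Lemma coordsP v : homogeneous F v ->
  supported (gr v) (coords B v) /\ v = combination (gr v) (coords B v).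
Proof.
move=> /piece_gr/combination_exists[c cv vE]; rewrite /coords.
by case: xgetP => [d _|/(_ c)[]].
Qed.

Lemma coords_unique v c : homogeneous F v ->
  supported (gr v) c -> v = combination (gr v) c -> coords B v = c.
Proof.
move=> /coordsP[dv dE] cv vE.
by apply: (combination_inj dv cv); rewrite -dE.
Qed.

Lemma coords_combination z c : supported z c -> coords B (combination z c) = c.
Proof.
move=> cz; have homc : homogeneous F (combination z c).
  by exists z; apply: combination_piece.
have [->|c0] := eqVneq c 0.
  rewrite combination0; apply: coords_unique.
  - by exists 0; apply: piece0.
  - exact: supported0.
  - by rewrite combination0.
by apply: coords_unique; rewrite ?gr_combination.
Qed.

End Coordinates.

(** * Leading terms *)

Section LeadingTerms.
Variables (K : fieldType) (F : bipersistence_module K) (m : nat) (B : 'I_m -> F).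
Hypotheses (freeF : fg_free F) (basisB : ordered_basis B).
Implicit Types (z w : grade) (c d : 'cV[K]_m) (u v : F) (i j : 'I_m) (S N G : set F).

Definition has_pivot u i : bool := is_pivot (coords B u) i.

Lemma coords0 : coords B 0 = 0.
Proof. by rewrite -(combination0 B 0) coords_combination //; apply: supported0. Qed.

Lemma coords_eq0 u : homogeneous F u -> coords B u = 0 -> u = 0.
Proof. by move=> /(coordsP freeF basisB)[_ {2}->] ->; rewrite combination0. Qed.

Lemma has_pivot_neq0 u i : has_pivot u i -> u <> 0.
Proof. by move=> + u0; rewrite u0 /has_pivot coords0 => /is_pivotP[]; rewrite mxE eqxx. Qed.

Lemma has_pivot_exists u : homogeneous F u -> u <> 0 -> exists i, has_pivot u i.
Proof.
move=> uF u0; apply: pivot_exists; apply/eqP => c0; apply: u0.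
exact: coords_eq0.
Qed.

Lemma pivot_le_gr u i : homogeneous F u -> has_pivot u i -> (gr (B i) <= gr u)%O.
Proof.
move=> /(coordsP freeF basisB)[su _] /is_pivotP[ui _].
by apply/negPn/negP => /su u0; rewrite u0 eqxx in ui.
Qed.

Lemma LT_combination u i : homogeneous F u -> has_pivot u i ->
  LT B u = combination B (gr u) (coords B u i 0 *: delta_mx i 0).
Proof.
move=> uF ui; rewrite combination_delta ?pivot_le_gr // /LT.
by case: pickP => [j /(pivot_unique ui) <- //|/(_ i)]; rewrite [is_pivot _ _]ui.
Qed.

Lemma LT_piece u : homogeneous F u -> piece F (gr u) (LT B u).
Proof.
move=> uF; have [[i ui]|Nu] := pselect (exists i, has_pivot u i).
  by rewrite (LT_combination uF ui); apply: combination_piece.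
rewrite /LT; case: pickP => [i ui|_]; last exact: piece0.
by case: Nu; exists i.
Qed.

Lemma LT_neq0 u i : homogeneous F u -> has_pivot u i -> LT B u <> 0.
Proof.
move=> uF ui; rewrite (LT_combination uF ui); apply: combination_neq0 => //.
  exact/supported_delta/pivot_le_gr.
apply/eqP => /colP/(_ i); rewrite !mxE !eqxx mulr1 => /eqP.
by apply/negP; case/is_pivotP: ui.
Qed.

Lemma leading_terms_homogeneous S : leading_terms B S `<=` homogeneous F.
Proof. by move=> _ [u [_ uF _] <-]; exists (gr u); exact: LT_piece. Qed.

Lemma leading_termsP S v : leading_terms B S v -> exists u i,
  [/\ S u, homogeneous F u, has_pivot u i & v = LT B u].
Proof.
move=> [u [Su uF u0] <-]; have [i ui] := has_pivot_exists uF u0.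
by exists u, i.
Qed.

(** Leading terms are multiples of single basis elements, so the coefficient at B i
    of a combination of leading terms only involves those with pivot i; in grade
    gr u, only those of grade at most gr u contribute. *)
Lemma LT_generatedP S u i : homogeneous F u -> has_pivot u i ->
  generated (leading_terms B S) (LT B u) <->
  exists s, [/\ S s, homogeneous F s, has_pivot s i & (gr s <= gr u)%O].
Proof.
move=> uF ui; split; last first.
  move=> [s [Ss sF si su]]; have sgen : generated (leading_terms B S) (LT B s).
    apply: sub_generated; exists s => //; split=> //.
    exact: has_pivot_neq0 si.
  have /is_pivotP[s0 _] := si.
  suff -> : LT B u =
      ((coords B u i 0 / coords B s i 0)%:MP * xpow K (gr u - gr s)) *: LT B s.
    exact: submodZ (submodule_generated _) _ _ sgen.
  rewrite !(LT_combination _ si) ?(LT_combination _ ui) // -scalerA.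
  rewrite combination_shift //; last exact/supported_delta/pivot_le_gr.
  by rewrite -combinationZ scalerA divfK.
move=> ugen.
have : graded_span (leading_terms B S) (gr u) (LT B u).
  apply: generated_piece_graded_span ugen _; first exact: leading_terms_homogeneous.
  exact: LT_piece.
rewrite (LT_combination uF ui).
suff key v : graded_span (leading_terms B S) (gr u) v -> exists c,
    [/\ supported B (gr u) c, v = combination B (gr u) c & forall j, c j 0 != 0 ->
      exists s, [/\ S s, homogeneous F s, has_pivot s j & (gr s <= gr u)%O]].
  move=> /key[c [cu cE]]; apply.
  have <- := combination_inj freeF basisB _ cu cE; last exact/supported_delta/pivot_le_gr.
  by rewrite !mxE !eqxx mulr1; case/is_pivotP: ui.
elim=> [|a _ w {}v /leading_termsP[s [j [Ss sF sj ->]]] sw wu _ [c [cu -> IH]]].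
  exists 0; split; [exact: supported0 | by rewrite combination0 |].
  by move=> j; rewrite mxE eqxx.
have sl : supported B (gr s) (coords B s j 0 *: delta_mx j 0).
  exact/supported_delta/pivot_le_gr.
have wE : gr s = w by apply: piece_inj (LT_piece sF) sw (LT_neq0 sF sj).
rewrite -wE in wu *; exists (a *: (coords B s j 0 *: delta_mx j 0) + c); split.
- by apply: supportedP => //; apply: supported_le sl.
- rewrite combinationP (LT_combination sF sj) -(combination_shift wu sl).
  by rewrite scalerA mul_mpolyC.
- move=> k; rewrite !mxE; have [->|kj] := eqVneq k j; first by exists s.
  by rewrite !mulr0 add0r; apply: IH.
Qed.

End LeadingTerms.

(** * Characterization and existence of minimal Groebner bases *)

Section GroebnerBases.
Variables (K : fieldType) (F : bipersistence_module K) (m : nat) (B : 'I_m -> F).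
Hypotheses (freeF : fg_free F) (basisB : ordered_basis B).
Implicit Types (z w : grade) (c d : 'cV[K]_m) (u v g h : F) (i j : 'I_m) (S G : set F).
Notation has_pivot := (has_pivot B).
Notation groebner_basis := (groebner_basis B).
Notation minimal_groebner_basis := (minimal_groebner_basis B).

Lemma coords_piece z v : piece F z v ->
  supported B z (coords B v) /\ v = combination B z (coords B v).
Proof.
move=> vz; have [v0|v0] := pselect (v = 0); last first.
  by rewrite -(gr_piece vz v0); apply: coordsP => //; exists z.
rewrite v0 coords0 // combination0; split=> //.
exact: supported0.
Qed.

Lemma shift_combination z v : homogeneous F v -> (gr v <= z)%O ->
  supported B z (coords B v) /\
  xpow K (z - gr v) *: v = combination B z (coords B v).
Proof.
move=> /(coordsP freeF basisB)[vs vE] vz; split; first exact: supported_le vs.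
by rewrite {2}vE combination_shift.
Qed.

Lemma pivot_gr z u i : piece F z u -> has_pivot u i -> gr u = z.
Proof. by move=> uz /(has_pivot_neq0 freeF basisB); apply: gr_piece. Qed.

(** By [LT_generatedP], this says that the leading terms of G generate L(N). *)
Definition covers (N G : set F) := forall u i, N u -> homogeneous F u -> has_pivot u i ->
  exists g, [/\ G g, homogeneous F g, has_pivot g i & (gr g <= gr u)%O].

Section Submodule.
Variables (H N : set F) (homH : H `<=` homogeneous F) (genN : N = generated H).

Let subN : submodule N.
Proof. by rewrite genN; apply: submodule_generated. Qed.

(** The division algorithm: subtracting a multiple of the element of G with the
    same pivot lowers the pivot. *)
Lemma covers_generated G u : G `<=` N -> covers N G -> N u -> homogeneous F u ->
  generated G u.
Proof.
move=> GN covG; have subG := submodule_generated G.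
suff key k v : N v -> homogeneous F v ->
    (forall i, (k <= i)%N -> coords B v i 0 = 0) -> generated G v.
  by move=> Nu uF; apply: (key m) => // i; rewrite leqNgt ltn_ord.
elim: k => [|k IH] in v *.
  move=> _ vF v0; suff -> : v = 0 by apply: subG.1.
  apply: (coords_eq0 freeF basisB) => //.
  by apply/colP => i; rewrite mxE v0.
move=> Nv vF vk; have [v0|v0] := pselect (v = 0); first by rewrite v0; apply: subG.1.
have [i vi] := has_pivot_exists freeF basisB vF v0.
have [g [Gg gF gi gv]] := covG _ _ Nv vF vi.
pose a := coords B v i 0 / coords B g i 0.
have [gs gE] := shift_combination gF gv.
have [vs vE] := coordsP freeF basisB vF.
pose r := (a%:MP * xpow K (gr v - gr g)) *: g.
have Gr : generated G r by apply: (submodZ subG); apply: sub_generated.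
have rE : v - r = combination B (gr v) (coords B v - a *: coords B g).
  by rewrite combinationB -vE combinationZ -gE scalerA.
rewrite -(subrK r v); apply: (submodD subG) => //.
have srs : supported B (gr v) (coords B v - a *: coords B g).
  by apply: supportedB => //; apply: supportedZ.
apply: IH.
- apply: (submodB subN) => //; apply: (submodZ subN); exact: GN.
- by exists (gr v); rewrite rE; apply: combination_piece.
- move=> j kj; rewrite rE coords_combination // !mxE.
  have /is_pivotP[vi0 vij] := vi; have /is_pivotP[gi0 gij] := gi.
  have [ij|] := ltnP i j; first by rewrite vij // gij // mulr0 subrr.
  have ik : (i <= k)%N.
    by rewrite leqNgt; apply/negP => /vk vi00; rewrite vi00 eqxx in vi0.
  move=> ji; have -> : j = i.
    by apply: ord_inj; apply/eqP; rewrite eqn_leq ji (leq_trans ik kj).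
  by rewrite /a divfK // subrr.
Qed.

Lemma groebner_basisP G : groebner_basis N G <->
  [/\ G `<=` homogeneous F, G `<=` N & covers N G].
Proof.
split=> [[[homG genG] LNG]|[homG GN covG]].
  split=> // [g Gg|u i Nu uF ui]; first by rewrite -genG; apply: sub_generated.
  apply/(LT_generatedP freeF basisB _ uF ui); rewrite -LNG.
  apply: sub_generated; exists u => //; split=> //.
  exact: has_pivot_neq0 ui.
split; first split=> //.
  apply/seteqP; split; first exact: generated_min.
  rewrite genN; apply: generated_sub => v Hv.
  apply: covers_generated => //; last exact: homH.
  by rewrite genN; apply: sub_generated.
apply/seteqP; split; apply: generated_sub.
  move=> _ /(leading_termsP freeF basisB)[u [i [Nu uF ui ->]]].
  apply/(LT_generatedP freeF basisB _ uF ui); exact: covG.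
move=> _ [g [Gg gF g0] <-]; apply: sub_generated; exists g => //.
by split=> //; apply: GN.
Qed.

(** Leading terms with different pivots do not interact, and the division algorithm
    makes generation of N automatic. So minimality means that among the elements
    with a given pivot the grades form an antichain. *)
Lemma minimal_groebner_basisP G : minimal_groebner_basis N G <->
  [/\ G `<=` homogeneous F, G `<=` N, covers N G &
      forall g, G g -> exists2 i, has_pivot g i &
        forall h, G h -> has_pivot h i -> (gr h <= gr g)%O -> h = g].
Proof.
split=> [[/groebner_basisP[homG GN covG] minG]|[homG GN covG redG]]; last first.
  split; first exact/groebner_basisP.
  move=> G' [G'G GG'] /groebner_basisP[homG' _ covG']; apply: GG' => g Gg.
  have [i gi gmin] := redG g Gg.
  have [h [Gh _ hi hg]] := covG' g i (GN _ Gg) (homG _ Gg) gi.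
  by rewrite -(gmin h (G'G _ Gh) hi hg).
have nored g : G g -> ~ covers N (G `\ g).
  move=> Gg cov; apply: (minG (G `\ g)).
    by split=> [x []//|/(_ g Gg)[_]]; apply.
  by apply/groebner_basisP; split=> // x [Gx _]; [apply: homG | apply: GN].
split=> // g Gg; have gF := homG _ Gg.
have [g0|g0] := pselect (g = 0).
  case: (nored g Gg) => u i Nu uF ui; have [h [Gh hF hi hu]] := covG _ _ Nu uF ui.
  exists h; split=> //; split=> //= hg.
  by apply: (has_pivot_neq0 freeF basisB hi); rewrite hg.
have [i gi] := has_pivot_exists freeF basisB gF g0; exists i => // h Gh hi hg.
apply: contrapT => neq; case: (nored g Gg) => u k Nu uF uk.
have [x [Gx xF xk xu]] := covG _ _ Nu uF uk.
have [xg|xg] := pselect (x = g); last by exists x.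
rewrite xg in xk xu; rewrite (pivot_unique xk gi).
exists h; split=> //; first exact: homG.
exact: le_trans hg xu.
Qed.

(** The grades at which i is a pivot of N form an up-set; its minimal elements are
    the grades of the elements with pivot i in any minimal Groebner basis. *)
Definition occurs z i := exists u, [/\ N u, piece F z u & has_pivot u i].

Definition minimal_occurrence z i :=
  occurs z i /\ forall w, (w <= z)%O -> occurs w i -> w = z.

Lemma occurs_basis z i : occurs z i -> (gr (B i) <= z)%O.
Proof.
move=> [u [_ uz ui]]; rewrite -(pivot_gr uz ui).
by apply: (pivot_le_gr freeF basisB) => //; exists z.
Qed.

(** Elements with pivot i have grade at least gr (B i), so a descending chain of
    such grades below z is finite. *)
Lemma minimal_occurrence_exists z i : occurs z i ->
  exists2 w, (w <= z)%O & minimal_occurrence w i.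
Proof.
(* The distance to the lower bound gr (B i) strictly decreases. *)
pose size z := (`|z.1 - (gr (B i)).1| + `|z.2 - (gr (B i)).2|)%N.
have [k] := ubnP (size z); elim: k => // k IH in z * => zk oz.
have [mz|Nmin] := pselect (minimal_occurrence z i); first by exists z.
have [w [wz ow wnz]] : exists w, [/\ (w <= z)%O, occurs w i & w <> z].
  apply: contrapT => Nw; apply: Nmin; split=> // w wz ow.
  by apply: contrapT => wnz; apply: Nw; exists w.
suff wk : (size w < k)%N.
  by have [x xw xmin] := IH w wk ow; exists x => //; apply: le_trans xw wz.
have := occurs_basis ow; move: zk wz wnz; rewrite /size !le_grade.
case: (gr (B i)) z w {oz ow Nmin} => [b1 b2] [z1 z2] [w1 w2] /=.
move=> zk /andP[le1 le2] wz /andP[ge1 ge2].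
suff : w1 <> z1 \/ w2 <> z2 by lia.
by have [e|/eqP] := eqVneq w1 z1; [right=> e2; apply: wz; rewrite e e2 | left].
Qed.

Lemma minimal_groebner_basis_exists : exists G, minimal_groebner_basis N G.
Proof.
have /choice[U UP] : forall p : grade * 'I_m, exists u, occurs p.1 p.2 ->
    [/\ N u, piece F p.1 u & has_pivot u p.2].
  by move=> p; have [[u uP]|No] := pselect (occurs p.1 p.2); [exists u | exists 0].
exists [set u | exists2 p, minimal_occurrence p.1 p.2 & U p = u].
apply/minimal_groebner_basisP; split.
- by move=> _ [p [/UP[_ ? _] _] <-]; exists p.1.
- by move=> _ [p [/UP[? _ _] _] <-].
- move=> u i Nu uF ui; have [|w wz wmin] := @minimal_occurrence_exists (gr u) i.
    by exists u; split=> //; apply: piece_gr.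
  have [_ Uw Ui] := UP (w, i) wmin.1.
  exists (U (w, i)); split=> //; [by exists (w, i) | by exists w |].
  by rewrite (pivot_gr Uw Ui).
move=> _ [p pmin <-]; have [_ Up Upi] := UP p pmin.1; exists p.2 => //.
move=> _ [q qmin <-] Uqi; have [_ Uq Uqi'] := UP q qmin.1.
rewrite (pivot_gr Up Upi) (pivot_gr Uq Uqi) => qp.
have pq2 := pivot_unique Uqi' Uqi.
have pq1 : q.1 = p.1 by apply: pmin.2 => //; rewrite -pq2; exact: qmin.1.
by rewrite [p]surjective_pairing [q]surjective_pairing pq1 pq2.
Qed.

End Submodule.
End GroebnerBases.

(** * Counting with sets *)

Section Counting.

Lemma card_le_fin (T : Type) (A : set T) (I : finType) (P : {set I}) (f : T -> I) :
  {in A &, injective f} -> (forall x, A x -> f x \in P) -> (A #<= `I_#|P|)%card.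
Proof.
move=> injf fP.
have PI : ([set` P] #<= `I_#|P|)%card.
  case: (set_0Vmem P) => [P0|[x0 x0P]].
    suff -> : [set` P] = set0 by apply: card_ge0.
    by apply/seteqP; split=> // x /=; rewrite P0 inE.
  have rk_inj : {in [set` P] &, injective (fun x => enum_rank_in x0P x : nat)}.
    move=> x y /set_mem /= xP /set_mem /= yP /val_inj.
    exact: enum_rank_in_inj.
  have := inj_card_eq rk_inj; rewrite card_eq_le => /andP[_].
  move=> /card_le_trans; apply; apply: subset_card_le => _ [x _ <-] /=.
  exact: ltn_ord.
apply: card_le_trans PI.
have := inj_card_eq injf; rewrite card_eq_le => /andP[_].
move=> /card_le_trans; apply; apply: subset_card_le => _ [x Ax <-] /=.
exact: fP.
Qed.

Lemma finite_set_enum (T : choiceType) (A : set T) : finite_set A ->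
  exists s : seq T, [/\ uniq s, A = [set` s] & (A #= `I_(size s))%card].
Proof.
move=> /finite_fsetP[X ->]; exists (finmap.enum_fset X); split.
- exact: finmap.fset_uniq.
- by [].
- exact/card_eq_fsetP.
Qed.

Lemma fsbig_set_seq (T : choiceType) (s : seq T) (f : T -> nat) : uniq s ->
  (\sum_(x \in [set` s]) f x = \sum_(x <- s) f x)%N.
Proof.
move=> us; rewrite (fsbigE s) //; last by move=> x xs /negP[].
rewrite big_seq_cond [RHS]big_seq; apply: eq_bigl => x.
by case: (boolP (x \in s)) => //= xs; apply/mem_set.
Qed.

Lemma fsbig_le (T : choiceType) (A : set T) (f : T -> nat) (k e : nat) :
  (A #<= `I_e)%card -> (forall x, f x <= k)%N -> (\sum_(x \in A) f x <= e * k)%N.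
Proof.
move=> Ae fk; have finA : finite_set A by apply/finite_set_leP; exists e.
have [s [us AE sA]] := finite_set_enum finA.
have se : (size s <= e)%N.
  rewrite -card_le_II; apply: card_le_trans Ae.
  by move: sA; rewrite card_eq_le => /andP[].
rewrite AE fsbig_set_seq //; apply: leq_trans (_ : \sum_(x <- s) k <= _)%N.
  exact: leq_sum.
by rewrite big_const_seq count_predT iter_addn_0 mulnC leq_mul2r se orbT.
Qed.

Lemma fsbig_ge (T : choiceType) (A : set T) (f : T -> nat) (k : nat)
    (I : finType) (g : I -> T) : finite_set A -> injective g ->
  (forall i, A (g i)) -> (forall i, k <= f (g i))%N ->
  (#|I| * k <= \sum_(x \in A) f x)%N.
Proof.
move=> finA injg gA fk; have [s [us AE _]] := finite_set_enum finA.
rewrite AE fsbig_set_seq //.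
rewrite -sum_nat_const; apply: leq_trans (_ : \sum_(i in I) f (g i) <= _)%N.
  exact: leq_sum.
have -> : (\sum_(i in I) f (g i) = \sum_(x <- [seq g i | i in I]) f x)%N.
  by rewrite big_image.
apply: (uniq_sub_le_big (op := addn) leqnn (fun x y => leq_addr y x)) => //.
  by rewrite /image_mem map_inj_uniq ?enum_uniq.
by move=> _ /fintype.imageP[i _ ->]; have := gA i; rewrite AE.
Qed.

Lemma card_ge_fin (T : choiceType) (A : set T) (I : finType) (g : I -> T) (e : nat) :
  (A #= `I_e)%card -> injective g -> (forall i, A (g i)) -> (#|I| <= e)%N.
Proof.
move=> Ae injg gA; have finA : finite_set A by apply/finite_setP; exists e.
have := fsbig_ge (f := fun=> 1%N) finA injg gA (fun=> leqnn _).
rewrite muln1 => /leq_trans; apply.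
have := fsbig_le (A := A) (f := fun=> 1%N) (k := 1) (e := e); rewrite muln1; apply=> //.
by move: Ae; rewrite card_eq_le => /andP[].
Qed.

End Counting.

(** * Upper bound *)

Section UpperBound.
Variables (K : fieldType) (F : bipersistence_module K) (m : nat) (B : 'I_m -> F).
Hypotheses (freeF : fg_free F) (basisB : ordered_basis B).
Variables (n : nat) (h : 'I_n -> F) (zh : 'I_n -> grade).
Hypothesis hP : forall j, piece F (zh j) (h j).
Let N := generated (range h).
Notation has_pivot := (has_pivot B).

Lemma range_homogeneous : range h `<=` homogeneous F.
Proof. by move=> _ [j _ <-]; exists (zh j). Qed.

Definition vanishes_above z (a : 'I_n -> K) := forall j, ~~ (zh j <= z)%O -> a j = 0.

Definition column_combination (a : 'I_n -> K) : 'cV[K]_m :=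
  \sum_j a j *: coords B (h j).

Lemma column_combination_supported z a : vanishes_above z a ->
  supported B z (column_combination a).
Proof.
move=> az; apply: supported_sum => j _.
have [jz|/az ->] := boolP (zh j <= z)%O; last by rewrite scale0r; apply: supported0.
apply: supportedZ; apply: (supported_le jz).
by have [] := coords_piece freeF basisB (hP j).
Qed.

Lemma column_combination_in z a : vanishes_above z a ->
  N (combination B z (column_combination a)).
Proof.
move=> az; rewrite combination_sum.
have subN : submodule N by apply: submodule_generated.
apply: (submod_sum subN) => j _; rewrite combinationZ.
have [jz|/az ->] := boolP (zh j <= z)%O; last by rewrite mpolyC0 scale0r; apply: subN.1.
apply: (submodZ subN).
have [js jE] := coords_piece freeF basisB (hP j).
rewrite -(combination_shift jz js) -jE; apply: (submodZ subN).
by apply: sub_generated; exists j.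
Qed.

(** In coordinates, the part of N of grade z is the span of the columns of the
    matrix of the presentation whose grade is at most z. *)
Lemma column_combination_exists z u : N u -> piece F z u ->
  exists2 a, vanishes_above z a & coords B u = column_combination a.
Proof.
move=> Nu uz.
have : graded_span (range h) z u.
  by apply: generated_piece_graded_span Nu uz; exact: range_homogeneous.
suff key v : graded_span (range h) z v -> exists2 a, vanishes_above z a &
    v = combination B z (column_combination a).
  move=> /key[a az ->]; exists a => //.
  by rewrite coords_combination //; apply: column_combination_supported.
elim=> [|c _ w {}v [j _ <-] jw wz _ [a az ->]].
  exists (fun=> 0) => //; rewrite /column_combination big1 ?combination0 // => j _.
  by rewrite scale0r.
have [j0|j0] := pselect (h j = 0); first by exists a => //; rewrite j0 scaler0 add0r.
have wE := piece_inj jw (hP j) j0; rewrite wE in wz *.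
exists (fun k => c * (k == j)%:R + a k).
  move=> k kz; rewrite az // addr0; case: eqP => [kj|]; last by rewrite mulr0.
  by rewrite kj wz in kz.
have -> : column_combination (fun k => c * (k == j)%:R + a k) =
    c *: coords B (h j) + column_combination a.
  rewrite /column_combination.
  under eq_bigr => k _ do rewrite scalerDl.
  rewrite big_split /= (bigD1 j) //= eqxx mulr1 big1 ?addr0 // => k /negbTE ->.
  by rewrite mulr0 scale0r.
have [js jE] := coords_piece freeF basisB (hP j).
rewrite combinationP -(combination_shift wz js) -jE.
by rewrite scalerA mul_mpolyC.
Qed.

Definition pivot_set : {set 'I_m} :=
  [set i | `[< exists u, [/\ N u, homogeneous F u & has_pivot u i] >]].

(** Vectors with distinct pivots are in echelon form, hence independent, and all
    coordinate vectors of N lie in the span of n columns of length m. *)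
Lemma card_pivot_set : (#|pivot_set| <= minn m n)%N.
Proof.
rewrite leq_min (leq_trans (max_card _)) ?card_ord //=.
have /choice[a aP] : forall p : 'I_#|pivot_set|, exists a : 'I_n -> K,
    is_pivot (column_combination a) (enum_val p).
  move=> p; have := enum_valP p; rewrite inE => /asboolP[u [Nu [z uz] ui]].
  have [a _ uE] := column_combination_exists Nu uz.
  by exists a; rewrite -uE.
pose A := \matrix_(p, j) a p j.
pose D := \matrix_(j, i) coords B (h j) i 0.
have ADE p i : (A *m D) p i = column_combination (a p) i 0.
  by rewrite mxE summxE; apply: eq_bigr => j _; rewrite !mxE.
suff : row_free (A *m D).
  rewrite /row_free => /eqP <-; apply: leq_trans (mxrankM_maxl _ _) _.
  exact: rank_leq_col.
apply: inj_row_free => v v0; apply/eqP/negPn/negP => /rV0Pn[p0 vp0].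
case: (@arg_maxnP _ p0 (fun p => v 0 p != 0) (fun p => enum_val p : nat) vp0).
move=> p vp pmax.
have /is_pivotP[pp _] := aP p.
have /rowP/(_ (enum_val p)) := v0; rewrite !mxE (bigD1 p) //= ADE big1; last first.
  move=> q qp; rewrite ADE; have [->|vq] := eqVneq (v 0 q) 0; first by rewrite mul0r.
  have /is_pivotP[_ ->] := aP q; first by rewrite mulr0.
  rewrite ltn_neqAle; apply/andP; split; last exact: pmax.
  by apply: contra qp => /eqP/ord_inj/enum_val_inj ->.
rewrite addr0 => /eqP; rewrite mulf_eq0 (negbTE vp) /= => /eqP p0'.
by rewrite p0' eqxx in pp.
Qed.

Section MinimalBasis.
Variables (G : set F) (minG : minimal_groebner_basis B N G).

(** If no column has the abscissa of gr g, the columns available at gr g are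
    already available one step to the left. The coordinate vector of g then occurs
    there too, with the same pivot, against the minimality of gr g. *)
Lemma minimal_grade_coordinate g : G g -> exists j, (zh j).1 = (gr g).1.
Proof.
move=> Gg.
have [homG GN covG redG] :=
  (minimal_groebner_basisP freeF basisB range_homogeneous erefl G).1 minG.
have [i gi gmin] := redG g Gg; have gF := homG _ Gg.
have [a az gE] := column_combination_exists (GN _ Gg) (piece_gr gF).
apply: contrapT => Nj.
pose w : grade := ((gr g).1 - 1, (gr g).2).
have aw : vanishes_above w a.
  move=> j; rewrite le_grade /= => jw; apply: az; apply: contra jw.
  rewrite le_grade => /andP[le1 ->]; rewrite andbT.
  have : (zh j).1 <> (gr g).1 by move=> e; apply: Nj; exists j.
  by move: le1; lia.
pose u := combination B w (column_combination a).
have us := column_combination_supported aw.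
have uE : coords B u = coords B g by rewrite gE coords_combination.
have ui : has_pivot u i by rewrite /has_pivot uE.
have uw : piece F w u by apply: combination_piece.
have uF : homogeneous F u by exists w.
have [x [Gx xF xi xu]] := covG u i (column_combination_in aw) uF ui.
rewrite (pivot_gr freeF basisB uw ui) in xu.
have wg : (w <= gr g)%O by rewrite le_grade /= lexx andbT; lia.
have xg := gmin x Gx xi (le_trans xu wg).
by move: xu; rewrite xg le_grade /=; lia.
Qed.

(** Elements with the same pivot have incomparable grades, so an element is
    determined by its pivot and the abscissa of its grade. There are at most
    min(m, n) pivots by [card_pivot_set] and n abscissas by
    [minimal_grade_coordinate]. *)
Lemma minimal_groebner_card : (0 < m)%N -> (0 < n)%N -> (G #<= `I_(n * minn m n))%card.
Proof.
move=> m0 n0.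
have [homG GN covG redG] :=
  (minimal_groebner_basisP freeF basisB range_homogeneous erefl G).1 minG.
have /choice[f fP] : forall g, exists p : 'I_n * 'I_m,
    G g -> (zh p.1).1 = (gr g).1 /\ has_pivot g p.2.
  move=> g; have [Gg|] := pselect (G g); last by exists (Ordinal n0, Ordinal m0).
  have [j jE] := minimal_grade_coordinate Gg; have [i gi _] := redG g Gg.
  by exists (j, i).
have fPset g : G g -> f g \in finset.setX (finset.setTfor 'I_n) pivot_set.
  move=> Gg; rewrite [f g]surjective_pairing finset.in_setX finset.in_setT inE.
  apply/asboolP; exists g; split.
  - exact: GN.
  - exact: homG.
  - by have [] := fP g Gg.
have finj : {in G &, injective f}.
  move=> g g' /set_mem Gg /set_mem Gg' fE.
  have [xg pg] := fP g Gg; have [xg' pg'] := fP g' Gg'.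
  have {}xg : (gr g).1 = (gr g').1 by rewrite -xg -xg' fE.
  rewrite -fE in pg'.
  have [i gi gmin] := redG g Gg; have [i' gi' gmin'] := redG g' Gg'.
  have e : i = (f g).2 := pivot_unique gi pg.
  have e' : i' = (f g).2 := pivot_unique gi' pg'.
  have [le|le] := leP (gr g).2 (gr g').2.
    by apply: gmin'; rewrite ?e' // le_grade xg lexx.
  by apply/esym/gmin; rewrite ?e // le_grade xg lexx (ltW le).
apply: card_le_trans (card_le_fin finj fPset) _.
by rewrite card_le_II cardsX finset.cardsT card_ord leq_mul2l card_pivot_set orbT.
Qed.

End MinimalBasis.
End UpperBound.

(** * Columns of binomial coefficients *)

Section Columns.
Variable K : fieldType.

(** The sequence 0, 1, 1, 0, -1, -1 of period six. *)
Definition hexagonal (s : nat) : K := (iter s (fun p => (p.2, p.2 - p.1)) (0, 1)).1.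

Lemma hexagonalSS s : hexagonal s.+2 = hexagonal s.+1 - hexagonal s.
Proof. by []. Qed.

(** Two consecutive zeros would propagate back to the initial value 1. *)
Lemma hexagonal_neq0 s : (hexagonal s != 0) || (hexagonal s.+1 != 0).
Proof.
elim: s => [|s IH]; first by rewrite [hexagonal 1]/= oner_eq0 orbT.
rewrite hexagonalSS; have [e|//] := eqVneq (hexagonal s.+1) 0.
by move: IH; rewrite e eqxx orbF sub0r oppr_eq0.
Qed.

Lemma hexagonal_count M s : (M./2 <= \sum_(p < M) (hexagonal (s + p) != 0%R))%N.
Proof.
(* Rows are consumed two at a time. *)
have [k] := ubnP M; elim: k => // k IH in M s *.
case: M => [|[|M]] // Mk.
have -> : (\sum_(p < M.+2) (hexagonal (s + p) != 0%R) = (hexagonal s != 0%R) +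
    ((hexagonal s.+1 != 0%R) + \sum_(p < M) (hexagonal (s.+2 + p) != 0%R)))%N.
  rewrite !big_ord_recl /= addn0 addn1; congr (_ + (_ + _))%N.
  by apply: eq_bigr => p _; rewrite /bump /= !add1n !addnS !addSn.
have := IH M s.+2; rewrite -ltnS => /(_ (ltnW Mk)).
have := hexagonal_neq0 s.
by case: (_ != 0); case: (_ != 0) => //= _; lia.
Qed.

Variables (m r : nat).

(** The k-th iterated difference, in j, of row p of the matrix with columns
    j = 0, 1, ... whose row m - 1 - q, for q < r, is C(j, q), and whose row p, for
    p < m - r, is the hexagonal sequence translated by p. Both kinds of rows have
    closed forms: a difference lowers q by one by Pascal's rule, and shifts the
    hexagonal sequence by two. *)
Definition entry (j k p : nat) : K :=
  if (p < m - r)%N then hexagonal (j + k.*2 + p)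
  else if (k <= m.-1 - p)%N then 'C(j, m.-1 - p - k)%:R else 0.

Lemma entryS j k p : entry j k.+1 p = entry j.+1 k p - entry j k p.
Proof.
rewrite /entry; case: ifP => _.
  by rewrite doubleS !addSn !addnS !addSn hexagonalSS.
have [kq|qk] := ltnP k (m.-1 - p).
  have [q ->] : exists q, (m.-1 - p = (k + q).+1)%N by exists (m.-1 - p - k.+1)%N; lia.
  rewrite ifT; last lia.
  rewrite subSS addKn subSn ?leq_addr // addKn binS natrD.
  rewrite [(k <= _)%N]leqW ?leq_addr //=.
  by rewrite -addrA addrC subrK.
case: ifP => kq; last by rewrite subrr.
have -> : (m.-1 - p - k = 0)%N by lia.
by rewrite !bin0 subrr.
Qed.

(** The coefficients are signed binomial coefficients; the argument only needs that
    the two extreme ones are nonzero, the last being 1. *)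
Lemma entry_differences k : exists nu : nat -> K,
  [/\ nu k = 1, nu 0 != 0 &
      forall j p, entry j k p = \sum_(l < k.+1) nu l * entry (j + l) 0 p].
Proof.
elim: k => [|k [nu [nuk nu0 IH]]].
  exists (fun=> 1); split=> // [|j p]; first exact: oner_neq0.
  by rewrite big_ord1 mul1r addn0.
exists (fun l => (if l is l'.+1 then nu l' else 0) - (if (l <= k)%N then nu l else 0)).
split=> [||j p]; first by rewrite nuk ltnn subr0.
  by rewrite sub0r oppr_eq0.
rewrite entryS !IH.
under [RHS]eq_bigr => l _ do rewrite mulrBl.
rewrite sumrB; congr (_ - _).
  rewrite [RHS]big_ord_recl /= mul0r add0r; apply: eq_bigr => l _ /=.
  by rewrite /bump /= add1n addSnnS.
rewrite [RHS]big_ord_recr /= ltnn mul0r addr0; apply: eq_bigr => l _.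
by rewrite -ltnS ltn_ord.
Qed.

(** Pascal's rule transports the equations from j + 1 to j, and for j = 0 the matrix
    of binomial coefficients is triangular with ones on the diagonal. So the
    characteristic of K does not matter. *)
Lemma pascal_free t j (mu : nat -> K) :
  (forall q, (q < t)%N -> \sum_(l < t) mu l * 'C(j + l, q)%:R = 0) ->
  forall l, (l < t)%N -> mu l = 0.
Proof.
elim: j => [|j IHj]; last first.
  move=> h; apply: IHj; elim=> [|q IHq] qt.
    by rewrite -[RHS](h _ qt); apply: eq_bigr => l _; rewrite !bin0.
  rewrite -[RHS](h _ qt) -[LHS]addr0 -[X in _ + X](IHq (ltnW qt)) -big_split /=.
  by apply: eq_bigr => l _; rewrite addSn binS natrD mulrDr.
elim: t => // t IHt h l; rewrite ltnS leq_eqVlt.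
have mut : mu t = 0.
  have := h t (leqnn _); rewrite big_ord_recr /= binn mulr1 big1 ?add0r // => i _.
  by rewrite add0n bin_small ?ltn_ord ?mulr0.
move=> /predU1P[->//|]; apply: IHt => q qt.
by have := h q (ltnW qt); rewrite big_ord_recr /= mut mul0r addr0.
Qed.

Definition column (j k : nat) : 'cV[K]_m := \col_p entry j k p.

Hypothesis rm : (r <= m)%N.

Lemma column_pivot j k (p : 'I_m) : (k < r)%N -> (p + k.+1 = m)%N ->
  is_pivot (column j k) p.
Proof.
move=> kr pk; apply/is_pivotP; split=> [|p' pp']; rewrite mxE /entry.
  rewrite ifF; last lia.
  rewrite ifT; last lia.
  have -> : (m.-1 - p - k = 0)%N by lia.
  by rewrite bin0 oner_neq0.
rewrite ifF; last lia.
by rewrite ifF //; have := ltn_ord p'; lia.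
Qed.

(** Subtracting from c the multiple of the k-th difference with the same coefficient
    at the column j + k leaves a combination of k columns that vanishes in the k
    rows of index q < k, which is zero by [pascal_free]. *)
Lemma pivot_column j k (p : 'I_m) (mu : nat -> K) (c : 'cV[K]_m) :
  (k < r)%N -> (p + k.+1 = m)%N ->
  c = \sum_(l < k.+1) mu l *: column (j + l) 0 -> is_pivot c p ->
  [/\ c = mu k *: column j k, mu k != 0 & mu 0 != 0].
Proof.
move=> kr pk cE /is_pivotP[cp chigh].
have [nu [nuk nu0 nuE]] := entry_differences k.
have cE' i : c i 0 = \sum_(l < k.+1) mu l * entry (j + l) 0 i.
  by rewrite cE summxE; apply: eq_bigr => l _; rewrite !mxE.
(* mu' k = 0: only the columns j, ..., j + k - 1 remain. *)
pose mu' l := mu l - mu k * nu l.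
have diff (i : 'I_m) : c i 0 - mu k * entry j k i = \sum_(l < k) mu' l * entry (j + l) 0 i.
  rewrite cE' nuE mulr_sumr -sumrB big_ord_recr /= nuk mul1r subrr addr0.
  by apply: eq_bigr => l _; rewrite mulrBl mulrA.
have mu'0 : forall l, (l < k)%N -> mu' l = 0.
  apply: (@pascal_free _ j) => q qk.
  have qm : (m.-1 - q < m)%N by lia.
  have := diff (Ordinal qm); rewrite chigh /=; last lia.
  have -> : entry j k (m.-1 - q) = 0.
    by rewrite /entry ifF; [rewrite ifF //; lia | lia].
  rewrite mulr0 subrr => /esym; apply: etrans; apply: eq_bigr => l _.
  rewrite /entry ifF; last lia.
  by rewrite subn0 subKn //; lia.
have cmu : c = mu k *: column j k.
  apply/colP => i; rewrite !mxE; apply/eqP; rewrite -subr_eq0 diff big1 // => l _.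
  by rewrite mu'0 ?mul0r.
have muk : mu k != 0.
  by apply: contra cp => /eqP e; rewrite cmu e scale0r mxE.
have mu0 : mu 0 = mu k * nu 0.
  have [k0|] := posnP k; last by move=> /mu'0/eqP; rewrite subr_eq0 => /eqP.
  by move: nuk; rewrite k0 => ->; rewrite mulr1.
by split=> //; rewrite mu0 mulf_neq0.
Qed.

(** The pivot lies among the binomial rows, and at least every second hexagonal row
    is nonzero. *)
Lemma column_support j k : (k < r)%N ->
  ((m - r)./2 < #|[pred p | column j k p 0%R != 0%R]|)%N.
Proof.
move=> kr; rewrite -sum1_card big_mkcond /=.
have -> : (\sum_(p < m) (if p \in [pred p | column j k p 0%R != 0%R] then 1 else 0) =
    \sum_(0 <= p < m) (entry j k p != 0%R))%N.
  rewrite big_mkord; apply: eq_bigr => p _; rewrite inE mxE.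
  by case: (_ == _).
rewrite (big_cat_nat (leq0n _) (leq_subr r m)) /= -addn1 leq_add //.
  rewrite big_mkord; apply: leq_trans (hexagonal_count (m - r) (j + k.*2)) _.
  by apply: leq_sum => p _; rewrite /entry ltn_ord.
have pm : (m - k.+1 < m)%N by lia.
have /is_pivotP[] : is_pivot (column j k) (Ordinal pm) by apply: column_pivot => //=; lia.
rewrite mxE /= => e0 _.
rewrite (bigD1_seq (m - k.+1)%N) /= ?iota_uniq ?mem_index_iota ?e0 //; lia.
Qed.

End Columns.

(** * Lower bound: the staircase *)

(** The join of the grades (l, n - 1 - l) for j <= l <= j + k; below it lie no
    other grades of this antichain. *)
Definition staircase_grade (n j k : nat) : grade := ((j + k)%N%:Z, (n.-1 - j)%N%:Z).

Section LowerBound.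
Variables (K : fieldType) (F : bipersistence_module K) (m : nat) (B : 'I_m -> F).
Hypotheses (freeF : fg_free F) (basisB : ordered_basis B).
Hypothesis grB0 : forall i, gr (B i) = 0.
Variables (n r : nat) (rm : (r <= m)%N).
Notation zg := (staircase_grade n).
Notation column := (column K m r).

Definition staircase_generator (j : 'I_n) : F := combination B (zg j 0) (column j 0).
Notation h := staircase_generator.
Let N := generated (range h).

Lemma supported_ge0 (z : grade) c : ((0 : grade) <= z)%O -> supported B z c.
Proof. by move=> z0 i; rewrite grB0 z0. Qed.

Lemma staircase_grade_ge0 j k : ((0 : grade) <= zg j k)%O.
Proof. by rewrite le_grade. Qed.

Let sup j k c : supported B (zg j k) c.
Proof. exact/supported_ge0/staircase_grade_ge0. Qed.

Let h_piece (j : 'I_n) : piece F (zg j 0) (h j).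
Proof. exact: combination_piece. Qed.

Lemma difference_in_image j k : (j + k < n)%N -> N (combination B (zg j k) (column j k)).
Proof.
have subN : submodule N by apply: submodule_generated.
elim: k j => [|k IH] j jk.
  rewrite addn0 in jk; apply: sub_generated.
  by exists (Ordinal jk).
(* The k + 1 columns from j on and those from j + 1 on both have joins below
   that of all k + 2 columns. *)
have -> : column j k.+1 = column j.+1 k - column j k.
  by apply/colP => p; rewrite !mxE entryS.
rewrite combinationB; apply: (submodB subN).
  rewrite -(@combination_shift _ _ _ _ (zg j.+1 k)) //; last by rewrite le_grade /=; lia.
  by apply: (submodZ subN); apply: IH; lia.
rewrite -(@combination_shift _ _ _ _ (zg j k)) //; last by rewrite le_grade /=; lia.
by apply: (submodZ subN); apply: IH; lia.
Qed.

Variables (G : set F) (minG : minimal_groebner_basis B N G).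

(** Some g in G has the pivot of the k-th difference at j and a grade below that of
    this difference, hence is a combination of the columns j, ..., j + k. By
    [pivot_column] it is proportional to the difference and involves both extreme
    columns, which forces its grade. *)
Lemma staircase_element j k (p : 'I_m) :
  (k < r)%N -> (j + k < n)%N -> (p + k.+1 = m)%N ->
  exists g, [/\ G g, gr g = zg j k, has_pivot B g p &
    exists2 a, a != 0 & coords B g = a *: column j k].
Proof.
move=> kr jk pk.
have homh : range h `<=` homogeneous F by move=> _ [i _ <-]; exists (zg i 0).
have [homG GN covG _] := (minimal_groebner_basisP freeF basisB homh erefl G).1 minG.
pose u := combination B (zg j k) (column j k).
have uz : piece F (zg j k) u by apply: combination_piece.
have ui : has_pivot B u p.
  by rewrite /has_pivot coords_combination //; apply: column_pivot.
have [|g [Gg gF gi]] := covG u p (difference_in_image jk) _ ui; first by exists (zg j k).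
rewrite (pivot_gr freeF basisB uz ui) => gz.
have [a az gE] := column_combination_exists freeF basisB h_piece (GN _ Gg) (piece_gr gF).
(* Columns indexed by nat, so that the range j, ..., j + k can be cut out. *)
pose b l := if insub l is Some i then a i else 0.
have bE (i : 'I_n) : b i = a i by rewrite /b valK.
have b0 l : b l != 0 -> (zg l 0 <= gr g)%O.
  rewrite /b; case: insubP => [i _ <-|]; last by rewrite eqxx.
  by apply: contraNT => /az ->.
have b0' l : b l != 0 -> (j <= l < j + k.+1)%N.
  move=> bl; have := le_trans (b0 _ bl) gz; rewrite le_grade /=.
  have : (l < n)%N by move: bl; rewrite /b; case: insubP => //; rewrite eqxx.
  by lia.
have cE : coords B g = \sum_(l < k.+1) b (j + l)%N *: column (j + l) 0.
  rewrite gE /column_combination.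
  under eq_bigr => i _ do rewrite coords_combination // -bE.
  rewrite -(big_mkord xpredT (fun l => b l *: column l 0)).
  have outside x y : (y <= j)%N || (j + k < x)%N ->
      \sum_(x <= l < y) b l *: column l 0 = 0.
    move=> xy; rewrite big_nat_cond; apply: big1 => l /andP[lxy _].
    by have [->|/b0'] := eqVneq (b l) 0; [rewrite scale0r | lia].
  rewrite (@big_cat_nat _ _ _ j) //=; last lia.
  rewrite outside ?leqnn // add0r.
  rewrite (@big_cat_nat _ _ _ (j + k.+1)) //=; [|lia..].
  rewrite [X in _ + X]outside ?addr0; last lia.
  rewrite -{1}[j]add0n big_addn addKn big_mkord.
  by apply: eq_bigr => l _; rewrite addnC.
have [cmu muk mu0] := pivot_column (mu := fun l => b (j + l)%N) rm kr pk cE gi.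
exists g; split=> //; last by exists (b (j + k)%N).
have := b0 _ muk; have := b0 _ mu0; move: gz.
rewrite !le_grade; case: (gr g) => z1 z2 /=; rewrite /staircase_grade => ? ? ?.
by congr (_, _); lia.
Qed.

Lemma staircase_nb_terms (g : F) j k a : (k < r)%N -> a != 0 ->
  coords B g = a *: column j k -> ((m - r)./2 < nb_terms B g)%N.
Proof.
move=> kr a0 gE; apply: leq_trans (@column_support K m r rm j k kr) _.
apply/eq_leq/eq_card => p; rewrite !inE gE !mxE mulf_eq0.
by rewrite (negbTE a0).
Qed.

(** An element of the staircase is determined by its grade and pivot. *)
Lemma staircase_elements : (r <= n)%N ->
  exists g : 'I_r * 'I_(n - r).+1 -> F,
  [/\ injective g, forall x, G (g x) & forall x, ((m - r)./2 < nb_terms B (g x))%N].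
Proof.
move=> rn.
have /choice[g gP] : forall x : 'I_r * 'I_(n - r).+1, exists g,
    [/\ G g, gr g = zg x.2 x.1,
        forall p : 'I_m, has_pivot B g p -> (p + x.1.+1 = m)%N &
        ((m - r)./2 < nb_terms B g)%N].
  move=> [k j] /=; have kr := ltn_ord k; have jn := ltn_ord j.
  have pm : (m - k.+1 < m)%N by lia.
  have [|||g [Gg gz gp [a a0 gE]]] := @staircase_element j k (Ordinal pm);
    rewrite //=; [lia..|].
  exists g; split=> // [p /(pivot_unique gp) <- /=|]; first by lia.
  exact: staircase_nb_terms gE.
exists g; split=> [x y gxy|x|x]; try by have [] := gP x.
have [Gx xz xp _] := gP x; have [Gy yz yp _] := gP y.
have : zg x.2 x.1 = zg y.2 y.1 by rewrite -xz -yz gxy.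
case: x y {gxy Gx xz xp Gy yz yp} => [k j] [k' j'] /= [e1 e2].
have := ltn_ord j; have := ltn_ord j'; have := ltn_ord k => ? ? ?.
by congr (_, _); apply: ord_inj; lia.
Qed.

End LowerBound.

(** * Instances and extremal values *)

Section StandardBasis.
Variables (K : fieldType) (r : nat) (g : 'I_r -> grade).
Notation R := {mpoly K[2]}.

Definition std_basis (i : 'I_r) : sumQ K g := (delta_mx 0 i : 'rV[R]_r).

Lemma std_basis_sum (v : 'rV[R]_r) : (v : sumQ K g) = \sum_i v 0 i *: std_basis i.
Proof. exact: row_sum_delta. Qed.

Lemma std_basis_piece i : piece (sumQ K g) (g i) (std_basis i).
Proof.
move=> j; rewrite /std_basis mxE eqxx /=; apply/QpieceP.
have [->|ji] := eqVneq j i.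
  by exists 1; rewrite scale1r subrr xpow0; split=> // _; apply: lexx.
by exists 0; rewrite scale0r eqxx.
Qed.

Lemma std_basis_neq0 i : std_basis i <> 0.
Proof.
by move=> /(congr1 (fun v : 'rV[R]_r => v 0 i)) /eqP; rewrite !mxE !eqxx oner_eq0.
Qed.

Lemma gr_std_basis i : gr (std_basis i) = g i.
Proof. exact: gr_piece (std_basis_piece i) (@std_basis_neq0 i). Qed.

(** Minimality: a proper subset misses some basis element i, and then generates
    elements with zero i-th coordinate only. *)
Lemma std_basis_ordered : ordered_basis std_basis.
Proof.
split.
- move=> i j /(congr1 (fun v : 'rV[R]_r => v 0 i)) /eqP.
  rewrite !mxE !eqxx /=; case: (i =P j) => // _.
  by rewrite oner_eq0.
- split; first by move=> _ [i _ <-]; exists (g i); apply: std_basis_piece.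
  apply/seteqP; split=> // v _; apply/generated_range.
  by exists (fun i => (v : 'rV[R]_r) 0 i); apply: std_basis_sum.
move=> S [Sr rS] [homS genS]; apply: rS => _ [i _ <-].
apply: contrapT => NSi.
pose T : set (sumQ K g) := [set v | (v : 'rV[R]_r) 0 i = 0].
have subT : submodule T.
  split=> [|a u v]; first by rewrite /T /= mxE.
  by rewrite /T /= => ui vi; rewrite !mxE ui vi mulr0 addr0.
have : T (std_basis i).
  have : generated S (std_basis i) by rewrite genS.
  apply: generated_min => // s Ss; have [j _ sE] := Sr s Ss.
  rewrite -sE /T /= mxE eqxx /=; case: (i =P j) => // ij.
  by case: NSi; rewrite ij sE; exact: Ss.
by rewrite /T /= mxE !eqxx => /eqP; rewrite oner_eq0.
Qed.

Lemma sumQ_free : fg_free (sumQ K g).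
Proof. by exists r, g, idfun, idfun; split=> [z v|z v|v|v]. Qed.

End StandardBasis.

Section LinearImage.
Variables (K : fieldType) (M M' : bipersistence_module K).
Variables (f : {linear M -> M'}) (n : nat) (b : 'I_n -> M).

Lemma range_linear : generated (range b) = setT ->
  range f = generated (range (f \o b)).
Proof.
move=> genb; apply/seteqP; split.
  move=> _ [v _ <-]; have /generated_range[p ->] : generated (range b) v by rewrite genb.
  apply/generated_range; exists p; rewrite linear_sum; apply: eq_bigr => i _.
  by rewrite linearZ.
move=> _ /generated_range[p ->]; exists (\sum_i p i *: b i) => //.
rewrite linear_sum; apply: eq_bigr => i _.
by rewrite linearZ.
Qed.

End LinearImage.

Section Instances.
Variables (K : fieldType) (m n : nat).
Hypotheses (m0 : (0 < m)%N) (n0 : (0 < n)%N).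

Lemma gb_instance_card (I : gb_instance K m n) :
  (@gb_set _ _ _ I #<= `I_(n * minn m n))%card.
Proof.
case: I => M M' f B' G freeM [b [_ [homb genb] _]] freeM' gf basisB' minG /=.
have /choice[z zP] : forall j, exists z, piece M z (b j).
  by move=> j; apply: homb; exists j.
have hP j : piece M' (z j) ((f \o b) j) by apply: gf.
rewrite (range_linear f genb) in minG.
exact: (@minimal_groebner_card K M' m B' freeM' basisB' n (f \o b) z hP G minG m0 n0).
Qed.

Lemma total_terms_le (I : gb_instance K m n) :
  (total_terms I <= m * n * minn m n)%N.
Proof.
rewrite -mulnA mulnC; apply: fsbig_le; first exact: gb_instance_card.
by move=> u; rewrite -[X in (_ <= X)%N]card_ord; apply: max_card.
Qed.

Lemma gb_set_finite (I : gb_instance K m n) : finite_set (@gb_set _ _ _ I).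
Proof. by apply/finite_set_leP; exists (n * minn m n)%N; apply: gb_instance_card. Qed.

(** The presentation with the columns of binomial coefficients in the antichain of
    grades (j, n - 1 - j), all rows having grade 0. *)
Lemma staircase_instance (r : nat) : (r <= minn m n)%N ->
  exists I : gb_instance K m n, exists g : 'I_r * 'I_(n - r).+1 -> gb_target I,
  [/\ injective g, forall x, @gb_set _ _ _ I (g x) &
      forall x, ((m - r)./2 < nb_terms (@gb_basis _ _ _ I) (g x))%N].
Proof.
rewrite leq_min => /andP[rm rn].
pose zg (j : 'I_n) := staircase_grade n j 0.
pose M := sumQ K zg; pose M' := sumQ K (fun _ : 'I_m => 0).
pose B' : 'I_m -> M' := @std_basis K m (fun=> 0).
have basisB' : ordered_basis B' by apply: std_basis_ordered.
have freeM' : fg_free M' by apply: sumQ_free.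
pose h : 'I_n -> M' := @staircase_generator K M' m B' n r.
pose A : 'M[{mpoly K[2]}]_(n, m) := \matrix_(j, i) (h j : 'rV_m) 0 i.
pose f : {linear M -> M'} := mulmxr A : {linear 'rV_n -> 'rV_m}.
have fE j : f (std_basis K zg j) = h j.
  by apply/rowP => i; rewrite /f /= -rowE !mxE.
have hP j : piece M' (zg j) (h j) by apply: combination_piece.
have gf : graded f.
  move=> z v vz.
  have term (p : {mpoly K[2]}) j : Qpiece (zg j) z p -> piece M' z (p *: h j).
    move=> /QpieceP[c [-> cz]].
    have [->|c0] := eqVneq c 0; first by rewrite !scale0r; exact: (piece0 M' z).
    rewrite -mul_mpolyC -scalerA; apply: (@pieceC _ M').
    rewrite -{1}(subrK (zg j) z) addrC; apply: piece_xpow => //.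
    by rewrite grade_subr_ge0; apply: cz.
  rewrite [v]std_basis_sum linear_sum; apply: (@piece_sum _ M') => j _.
  by rewrite linearZ fE; apply: term; exact: vz.
have homh : range h `<=` homogeneous M' by move=> _ [j _ <-]; exists (zg j).
have [G minG] := minimal_groebner_basis_exists freeM' basisB' homh erefl.
have basisM := std_basis_ordered K zg.
have rangeE : range f = generated (range h).
  have [_ [_ genM] _] := basisM; rewrite (range_linear f genM).
  suff -> : f \o std_basis K zg = h by [].
  by apply/funext => j; rewrite /comp fE.
have minG' : minimal_groebner_basis B' (range f) G by rewrite rangeE.
have freeM : fg_free M by apply: sumQ_free.
have rankM : free_rank M n by exists (std_basis K zg).
exists (GbInstance freeM rankM freeM' gf basisB' minG').
have gr0 i : gr (B' i) = 0 by apply: gr_std_basis.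
have := staircase_elements freeM' basisB' gr0 rm minG rn.
by move=> [g gP]; exists g.
Qed.

End Instances.

Lemma max_nat_exists (P : nat -> Prop) (b : nat) :
  (exists e, P e) -> (forall e, P e -> (e <= b)%N) ->
  exists2 e, P e & forall e', P e' -> (e' <= e)%N.
Proof.
move=> [e0 Pe0] Pb.
have ex : exists e, `[< P e >] by exists e0; apply/asboolP.
have bd e : `[< P e >] -> (e <= b)%N by move=> /asboolP; apply: Pb.
case: (ex_maxnP ex bd) => e /asboolP Pe emax; exists e => // e' Pe'.
by apply: emax; apply/asboolP.
Qed.

Section Extremal.
Variables (K : fieldType) (m n : nat).
Hypotheses (m0 : (0 < m)%N) (n0 : (0 < n)%N).
Let r := uphalf (minn m n).

Let r_min : (r <= minn m n)%N.
Proof. by rewrite /r; lia. Qed.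

(** With r = ceil(min(m, n) / 2), the staircase has r (n - r + 1) elements,
    and n <= 2 (n - r + 1). *)
Lemma max_elements_exists : exists e, [/\ max_elements K m n e,
  (n * minn m n <= 4 * e)%N & (e <= n * minn m n)%N].
Proof.
have bound (I : gb_instance K m n) e :
    (@gb_set _ _ _ I #= `I_e)%card -> (e <= n * minn m n)%N.
  move=> Ie; rewrite -card_le_II; apply: card_le_trans (gb_instance_card m0 n0 I).
  by move: Ie; rewrite card_eq_le => /andP[].
have card (I : gb_instance K m n) : exists e, (@gb_set _ _ _ I #= `I_e)%card.
  exact/finite_setP/gb_set_finite.
have [I0 [g [ginj gG _]]] := staircase_instance K r_min.
pose attained e := exists I : gb_instance K m n, (@gb_set _ _ _ I #= `I_e)%card.
have [e [I Ie] emax] :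
    exists2 e, attained e & forall e', attained e' -> (e' <= e)%N.
  apply: (@max_nat_exists _ (n * minn m n)); last by move=> e [I]; apply: bound.
  by have [e eP] := card I0; exists e, I0.
exists e; split; [split; first by exists I| |exact: bound Ie].
  move=> J; have [e' Je'] := card J.
  move: (Je'); rewrite card_eq_le => /andP[Je _]; apply: card_le_trans Je _.
  by rewrite card_le_II; apply: emax; exists J.
have [e0 I0e0] := card I0.
have := card_ge_fin I0e0 ginj gG; rewrite card_prod !card_ord => re0.
have e0e : (e0 <= e)%N by apply: emax; exists I0.
move: r_min re0; rewrite /r; nia.
Qed.

Lemma max_terms_exists : exists t, [/\ max_terms K m n t,
  (m * n * minn m n <= 16 * t)%N & (t <= m * n * minn m n)%N].
Proof.
have [I0 [g [ginj gG gt]]] := staircase_instance K r_min.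
pose attained t := exists I : gb_instance K m n, total_terms I = t.
have [t [I It] tmax] :
    exists2 t, attained t & forall t', attained t' -> (t' <= t)%N.
  apply: (@max_nat_exists _ (m * n * minn m n)); first by exists (total_terms I0), I0.
  by move=> _ [I <-]; apply: total_terms_le.
exists t; split.
- split; first by exists I; split=> //; apply: gb_set_finite.
  move=> J; split; first exact: gb_set_finite.
  by apply: tmax; exists J.
- have := fsbig_ge (gb_set_finite m0 n0 I0) ginj gG gt.
  rewrite card_prod !card_ord => le0.
  have : (r * (n - r).+1 * ((m - r)./2).+1 <= t)%N.
    by apply: leq_trans le0 _; apply: tmax; exists I0.
  move: r_min; rewrite /r => rmin.
  (* Each factor is bounded below separately, with constants 2, 2 and 4. *)
  have h1 : (minn m n <= 2 * uphalf (minn m n))%N by lia.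
  have h2 : (n <= 2 * (n - uphalf (minn m n)).+1)%N by lia.
  have h3 : (m <= 4 * ((m - uphalf (minn m n))./2).+1)%N by lia.
  have := leq_mul (leq_mul h3 h2) h1.
  nia.
- by rewrite -It; apply: total_terms_le.
Qed.

End Extremal.

Theorem proposition3p8 (K : fieldType) :
  exists E T : nat -> nat -> nat,
    [/\ forall m n, (0 < m)%N -> (0 < n)%N -> max_elements K m n (E m n),
        forall m n, (0 < m)%N -> (0 < n)%N -> max_terms K m n (T m n),
        Theta E (fun m n => (n * minn m n)%N) &
        Theta T (fun m n => (m * n * minn m n)%N)].
Proof.
have /choice[E EP] : forall p : nat * nat, exists e, (0 < p.1)%N -> (0 < p.2)%N ->
    [/\ max_elements K p.1 p.2 e, (p.2 * minn p.1 p.2 <= 4 * e)%N &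
        (e <= p.2 * minn p.1 p.2)%N].
  move=> [m n] /=; case: (posnP m) => [->|m0]; first by exists 0%N.
  case: (posnP n) => [->|n0]; first by exists 0%N.
  by have [e eP] := max_elements_exists K m0 n0; exists e.
have /choice[T TP] : forall p : nat * nat, exists t, (0 < p.1)%N -> (0 < p.2)%N ->
    [/\ max_terms K p.1 p.2 t, (p.1 * p.2 * minn p.1 p.2 <= 16 * t)%N &
        (t <= p.1 * p.2 * minn p.1 p.2)%N].
  move=> [m n] /=; case: (posnP m) => [->|m0]; first by exists 0%N.
  case: (posnP n) => [->|n0]; first by exists 0%N.
  by have [t tP] := max_terms_exists K m0 n0; exists t.
have theta (f g : nat -> nat -> nat) k : (0 < k)%N ->
    (forall m n, (0 < m)%N -> (0 < n)%N ->
      (g m n <= k * f m n)%N /\ (f m n <= g m n)%N) ->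
    Theta f g.
  move=> k0 fg; exists k%:R^-1, 1; split=> [||m n m0 n0]; rewrite ?invr_gt0 ?ltr0n //.
  have [gf fle] := fg m n m0 n0; rewrite mul1r ler_nat fle andbT.
  by rewrite ler_pdivrMl ?ltr0n // -natrM ler_nat.
exists (fun m n => E (m, n)), (fun m n => T (m, n)); split=> [m n m0 n0|m n m0 n0||].
- by have [] := EP (m, n) m0 n0.
- by have [] := TP (m, n) m0 n0.
- by apply: (theta _ _ 4%N) => // m n m0 n0; have [] := EP (m, n) m0 n0.
- by apply: (theta _ _ 16%N) => // m n m0 n0; have [] := TP (m, n) m0 n0.
Qed.
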